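(* Let $w\in S_\mathbb{Z}$. Then ${\overleftarrow{\mathfrak{G}}}_w(x;a)=(-1)^{\ell(w)}\sum_D\mathrm{wt}(D)$, where the sum is over all $K$-bumpless pipedreams $D$ with $w(D)=w$.
   Context: $S_\mathbb{Z}$: permutations of $\mathbb{Z}$ fixing all but finitely many integers, generated by $s_i$ exchanging $i,i+1$; $\ell$ length; $S_n\subset S_+=\langle s_i:i>0\rangle$; $\gamma(s_i)=s_{i+1}$. $a\ominus b=(a-b)/(1-b)$. $\tilde\pi_i f=\frac{(1-x_{i+1})f-(1-x_i)s_i(f)}{x_i-x_{i+1}}$. Double Grothendieck polynomials for $w\in S_n$: $\mathfrak{G}_{w_0}(x;a)=\prod_{i+j\le n}(x_i\ominus a_j)$ and $\mathfrak{G}_w(x;a)=\tilde\pi_i\mathfrak{G}_{ws_i}(x;a)$ when $\ell(ws_i)>\ell(w)$. ${\overleftarrow{\mathfrak{G}}}_w(x;a)$ is the coefficientwise limit as $p\to-\infty$ of $\mathfrak{G}_{\gamma^{1-p}(w)}(x;a)$ with $x_i\mapsto x_{i+p-1}$, $a_i\mapsto a_{i+p-1}$ (formal power series). Use matrix coordinates: $(i,j)$ is the unit square in row $i$ and column $j$, rows increasing downward, columns to the right. The six tiles are: empty; NW elbow (a pipe joining the north and west edges); SE elbow (joining south and east edges); horizontal line; vertical line; crossing. A $K$-bumpless pipedream is a tiling of $\mathbb{Z}\times\mathbb{Z}$ by these tiles with pipe ends matching across edges, such that for all $N\gg0$ and all $N\ll0$ there is a pipe travelling north from $(\infty,N)$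 to the square $(N,N)$, where it turns east and travels towards $(N,\infty)$. For each $i\in\mathbb{Z}$ a pipe enters from the south in column $i$; follow it until it heads east towards $(j,\infty)$, ignoring all crossings between pairs of pipes that have already crossed (reading pipes from southwest to northeast); then $w(D)$ is defined by $w(D)(j)=i$. The weight is $\mathrm{wt}(D)=\prod_{(i,j)\ \text{empty}}\bigl(-(x_i\ominus a_j)\bigr)\prod_{(i,j)\ \text{NW elbow}}\bigl(1-(x_i\ominus a_j)\bigr)$. *)

(* Defs.v *)
From HB Require Import structures.
From mathcomp Require Import all_boot all_order all_algebra.
From mathcomp Require Import finmap monalg.
From mathcomp Require Import mathcomp_extra boolp classical_sets functions.
From mathcomp Require Import cardinality fsbigop.
From mathcomp Require Import zify ring.

Set Implicit Arguments.
Unset Strict Implicit.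
Unset Printing Implicit Defensive.

Import Order.TTheory GRing.Theory Num.Theory.

Local Open Scope classical_set_scope.
Local Open Scope ring_scope.

Section Monomials.
Context {I : choiceType}.
Implicit Types (m d e : {cmonom I}) (u v : I).

Lemma cmP_eq m d : (forall v, m v = d v) -> m = d.
Proof. by move=> h; apply/eqP/cmP. Qed.

Definition mdivisors m : set ({cmonom I} * {cmonom I}) :=
  [set p | mmul p.1 p.2 = m].

Lemma finite_mdivisors m : finite_set (mdivisors m).
Proof.
pose K := (mdeg m).+1.
pose g (phi : {ffun finsupp m -> 'I_K}) : {cmonom I} :=
  [cmonom (phi v : nat) | v : finsupp m]%M.
have gP d e : mmul d e = m ->
    d = g [ffun v : finsupp m => inord (d (val v))].
  move=> dem; apply: cmP_eq => v; rewrite cmE fsfun_ffun.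
  case: insubP => [w _ wv|vm] /=.
    rewrite ffunE wv inordK // ltnS.
    apply: (@leq_trans (m v)); first by rewrite -dem cmM leq_addr.
    rewrite mdegE -wv (big_fsetD1 (val w)) ?fsvalP //=.
    exact: leq_addr.
  have : m v = 0%N by apply/eqP; rewrite cmE_eq0.
  by rewrite -dem cmM => /eqP; rewrite addn_eq0 => /andP[/eqP].
apply: (@sub_finite_set _ _ ((fun q => (g q.1, g q.2)) @` setT)); last first.
  exact/finite_image/finite_finset.
move=> [d e] /= dem.
exists ([ffun v : finsupp m => inord (d (val v))],
        [ffun v : finsupp m => inord (e (val v))]) => //=.
by rewrite -(gP _ _ dem) -(gP e d) // mulmC.
Qed.

Lemma mdivisors_seq m : exists2 S : seq {cmonom I}, uniq S &
  forall d e, mmul d e = m -> d \in S /\ e \in S.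
Proof.
have fD := finite_image fst (finite_mdivisors m).
exists (fset_set (fst @` mdivisors m)) => [|d e dem]; first exact: fset_uniq.
split; rewrite in_fset_set // inE /=.
  by exists (d, e).
by exists (e, d) => //; rewrite /mdivisors /= mulmC.
Qed.

(* The monomial [m \o s], where [t] is the inverse of the bijection [s]. *)
Definition mcomp (s t : I -> I) m : {cmonom I} :=
  [cmonom m (s v) | v in [fset t u | u in finsupp m]%fset]%M.

Lemma mcompE s t m v : cancel s t -> mcomp s t m v = m (s v).
Proof.
move=> st; rewrite cmE fsfun_fun; case: ifPn => // vm.
apply/esym/eqP; rewrite cmE_eq0; apply: contra vm => svm.
by apply/imfsetP; exists (s v) => //=; rewrite st.
Qed.

End Monomials.

Record fps (I : choiceType) := FPS { coef : {cmonom I} -> int }.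

HB.instance Definition _ (I : choiceType) := [isNew for @coef I].
HB.instance Definition _ (I : choiceType) := [Choice of fps I by <:].

Section PowerSeries.
Context {I : choiceType}.
Implicit Types (f g h : fps I) (m d e : {cmonom I}) (u v : I).

Lemma fpsP f g : (forall m, coef f m = coef g m) -> f = g.
Proof. by case: f g => [f] [g] /= /funext ->. Qed.

Definition fps0 : fps I := FPS (fun=> 0).
Definition fps_opp f : fps I := FPS (fun m => - coef f m).
Definition fps_add f g : fps I := FPS (fun m => coef f m + coef g m).

(* Locked, as unification would otherwise unfold them when comparing two
   distinct series. *)
Fact fps1_key : unit. Proof. by []. Qed.
Fact fps_mul_key : unit. Proof. by []. Qed.
Fact fpsX_key : unit. Proof. by []. Qed.
Definition fps1 : fps I :=
  locked_with fps1_key (FPS (fun m => (m == mone)%:R)).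
Definition fps_mul f g : fps I := locked_with fps_mul_key
  (FPS (fun m => \sum_(p \in mdivisors m) (coef f p.1 * coef g p.2))).
Definition fpsX v : fps I :=
  locked_with fpsX_key (FPS (fun m => (m == ucm v)%:R)).

Lemma coef1 m : coef fps1 m = (m == mone)%:R.
Proof. by rewrite /fps1 locked_withE. Qed.

Lemma coefX v m : coef (fpsX v) m = (m == ucm v)%:R.
Proof. by rewrite /fpsX locked_withE. Qed.

Lemma fps_addA : associative fps_add.
Proof. by move=> f g h; apply: fpsP => m /=; rewrite addrA. Qed.
Lemma fps_addC : commutative fps_add.
Proof. by move=> f g; apply: fpsP => m /=; rewrite addrC. Qed.
Lemma fps_add0 : left_id fps0 fps_add.
Proof. by move=> f; apply: fpsP => m /=; rewrite add0r. Qed.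
Lemma fps_addN : left_inverse fps0 fps_opp fps_add.
Proof. by move=> f; apply: fpsP => m /=; rewrite addNr. Qed.

HB.instance Definition _ := GRing.isZmodule.Build (fps I)
  fps_addA fps_addC fps_add0 fps_addN.

Lemma coef_mul f g m (S : seq {cmonom I}) : uniq S ->
  (forall d e, mmul d e = m -> d \in S /\ e \in S) ->
  coef (fps_mul f g) m =
    \sum_(d <- S) \sum_(e <- S) coef f d * coef g e *+ (mmul d e == m).
Proof.
move=> uS hS; rewrite /fps_mul locked_withE /= (fsbig_finite _ _ (finite_mdivisors m)) /=.
rewrite -(big_allpairs_dep (h := pair) (r1 := S) (r2 := fun=> S)
  (F := fun p => coef f p.1 * coef g p.2 *+ (mmul p.1 p.2 == m))) /=.
under [RHS]eq_bigr do rewrite mulrb.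
rewrite -big_mkcond /= -[RHS]big_filter; apply: perm_big; apply: uniq_perm.
- exact: fset_uniq.
- by apply/filter_uniq/allpairs_uniq => // -[? ?] [? ?].
move=> [d e]; rewrite in_fset_set; last exact: finite_mdivisors.
rewrite mem_filter; apply/idP/andP; rewrite inE /mdivisors /=.
  move=> dem; have [dS eS] := hS _ _ dem; split; first exact/eqP.
  by apply/allpairsP; exists (d, e).
by move=> [/eqP].
Qed.

Lemma fps_mulC : commutative fps_mul.
Proof.
move=> f g; apply: fpsP => m; have [S uS hS] := mdivisors_seq m.
rewrite !(coef_mul _ _ uS hS) exchange_big /=.
by apply: eq_bigr => d _; apply: eq_bigr => e _; rewrite mulrC mulmC.
Qed.

Lemma fps_mul1 : left_id fps1 fps_mul.
Proof.
move=> f; apply: fpsP => m; have [S uS hS] := mdivisors_seq m.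
have [S1 Sm] := hS _ _ (mul1m m).
rewrite (coef_mul _ _ uS hS) (bigD1_seq (mone : {cmonom I})) //=.
rewrite [X in _ + X]big1 ?addr0 => [|d /negPf d1]; last first.
  by rewrite big1 // => e _; rewrite coef1 d1 mul0r mul0rn.
rewrite (bigD1_seq m) //= big1 => [|e em]; last first.
  by rewrite mul1m (negPf em) mulr0n.
by rewrite coef1 !eqxx mul1m eqxx mul1r mulr1n addr0.
Qed.

Lemma fps_mulDl : left_distributive fps_mul fps_add.
Proof.
move=> f g h; apply: fpsP => m; have [S uS hS] := mdivisors_seq m.
transitivity (coef (fps_mul f h) m + coef (fps_mul g h) m); last by [].
rewrite !(coef_mul _ _ uS hS) -big_split /=.
apply: eq_bigr => d _; rewrite -big_split /=.
by apply: eq_bigr => e _; rewrite mulrDl mulrnDl.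
Qed.

Lemma fps_mulA : associative fps_mul.
Proof.
have key f g h m (S : seq {cmonom I}) : uniq S ->
    (forall d e, mmul d e = m -> d \in S /\ e \in S) ->
    coef (fps_mul (fps_mul f g) h) m =
    \sum_(a <- S) \sum_(b <- S) \sum_(e <- S)
      coef f a * coef g b * coef h e *+ (mmul (mmul a b) e == m).
  move=> uS hS; rewrite (coef_mul _ _ uS hS).
  transitivity (\sum_(d <- S) \sum_(e <- S) \sum_(a <- S) \sum_(b <- S)
    coef f a * coef g b * coef h e *+
      ((mmul a b == d) && (mmul d e == m))).
    apply: eq_bigr => d _; apply: eq_bigr => e _.
    have [dem|] := eqVneq (mmul d e) m; last first.
      rewrite mulr0n => _; rewrite big1 // => a _; rewrite big1 // => b _.
      by rewrite andbF.
    rewrite mulr1n (@coef_mul _ _ d S) //; last first.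
      move=> a b abd.
      have [aS _] := hS a (mmul b e) (etrans (mulmA _ _ _) (etrans
        (congr1 (mmul^~ e) abd) dem)).
      have [bS _] := hS b (mmul a e) (etrans (mulmA _ _ _) (etrans
        (congr1 (mmul^~ e) (etrans (mulmC _ _) abd)) dem)).
      by [].
    rewrite big_distrl; apply: eq_bigr => a _ /=; rewrite big_distrl.
    by apply: eq_bigr => b _ /=; rewrite andbT mulrnAl.
  rewrite exchange_big /=.
  under eq_bigr do rewrite exchange_big /=.
  rewrite exchange_big /=; apply: eq_bigr => a _.
  under eq_bigr do rewrite exchange_big /=.
  rewrite exchange_big /=; apply: eq_bigr => b _; apply: eq_bigr => e _.
  have [abem|abem] := eqVneq (mmul (mmul a b) e) m; last first.
    rewrite mulr0n big1 // => d _.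
    by case: eqVneq => //= <-; rewrite (negPf abem).
  have [abS _] := hS _ _ abem.
  rewrite (bigD1_seq (mmul a b)) //= big1 ?addr0 ?eqxx ?abem ?eqxx // => d.
  by rewrite eq_sym => /negPf ->.
move=> f g h; apply: fpsP => m; have [S uS hS] := mdivisors_seq m.
rewrite fps_mulC !(key _ _ _ _ _ uS hS).
under eq_bigr do rewrite exchange_big /=.
rewrite exchange_big /=.
apply: eq_bigr => a _; apply: eq_bigr => b _; apply: eq_bigr => c _.
by rewrite mulrC mulrA mulmC mulmA.
Qed.

Lemma fps1_neq0 : fps1 != 0.
Proof.
by apply/eqP => /(congr1 (fun f => coef f mone)); rewrite coef1 eqxx.
Qed.

HB.instance Definition _ := GRing.Zmodule_isComNzRing.Build (fps I)
  fps_mulA fps_mulC fps_mul1 fps_mulDl fps1_neq0.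

Definition fps_unit : {pred fps I} := fun f => `[< exists g, g * f = 1 >].
Definition fps_inv f : fps I :=
  if f \in fps_unit then xget 0 [set g | g * f = 1] else f.

Lemma fps_mulVr : {in fps_unit, left_inverse 1 fps_inv *%R}.
Proof.
move=> f fU; rewrite /fps_inv fU; case: xgetP => //= fN.
by move/asboolP: fU => -[g /fN].
Qed.

Lemma fps_unitP f g : g * f = 1 -> f \in fps_unit.
Proof. by move=> gf; apply/asboolP; exists g. Qed.

Lemma fps_inv_out : {in [predC fps_unit], fps_inv =1 id}.
Proof. by move=> f /negPf fN; rewrite /fps_inv fN. Qed.

HB.instance Definition _ := GRing.ComNzRing_hasMulInverse.Build (fps I)
  fps_mulVr fps_unitP fps_inv_out.

Lemma coefD f g m : coef (f + g) m = coef f m + coef g m.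
Proof. by []. Qed.

Lemma coefN f m : coef (- f) m = - coef f m.
Proof. by []. Qed.

Lemma coefB f g m : coef (f - g) m = coef f m - coef g m.
Proof. by []. Qed.

Lemma coefXM v f m :
  coef (fpsX v * f) m = if (0 < m v)%N then coef f (divcm m (ucm v)) else 0.
Proof.
have [S uS hS] := mdivisors_seq m.
rewrite (coef_mul _ _ uS hS).
have off d : d != ucm v ->
    \sum_(e <- S) coef (fpsX v) d * coef f e *+ (mmul d e == m) = 0.
  by move=> /negPf dv; rewrite big1 // => e _; rewrite coefX dv mul0r mul0rn.
case: ifPn => [mv|].
  have vm : mmul (ucm v) (divcm m (ucm v)) = m.
    apply: cmP_eq => w; rewrite cmM divcmE cmU.
    by case: eqVneq mv => [->|]; lia.
  have [vS eS] := hS _ _ vm.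
  rewrite (bigD1_seq (ucm v)) //= [X in _ + X]big1 ?addr0; last first.
    by move=> d /off.
  rewrite (bigD1_seq (divcm m (ucm v))) //= coefX vm !eqxx mul1r mulr1n.
  rewrite [X in _ + X]big1; first exact: addr0.
  move=> e /eqP enq.
  have [vem|_] := eqVneq (mmul (ucm v) e) m; last by rewrite mulr0n.
  case: enq; apply: cmP_eq => w; rewrite divcmE -vem cmM; lia.
rewrite -eqn0Ngt => /eqP mv.
rewrite big1 // => d _; have [->|/off //] := eqVneq d (ucm v).
rewrite big1 // => e _.
have [vem|_] := eqVneq (mmul (ucm v) e) m; last by rewrite mulr0n.
by move: mv; rewrite -vem cmM cmUU.
Qed.

Lemma unit_1subX v : 1 - fpsX v \is a GRing.unit.
Proof.
apply/unitrPr.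
pose q : fps I := FPS (fun m => `[< forall w, w != v -> m w = 0%N >]%:R).
exists q; rewrite mulrBl mul1r; apply: fpsP => m; rewrite coefB coefXM coef1 /=.
have [->|] := eqVneq m mone.
  rewrite cm1 ltnn subr0; case: asboolP => // -[] w _; exact: cm1.
move=> m1; case: ifPn => [mv|].
  suff -> : `[< forall w, w != v -> divcm m (ucm v) w = 0%N >]
         = `[< forall w, w != v -> m w = 0%N >] by rewrite subrr.
  apply: asbool_equiv_eq; split => h w wv; move: (h w wv);
    by rewrite divcmE cmU eq_sym (negPf wv) subn0.
rewrite -eqn0Ngt => /eqP mv; rewrite subr0; case: asboolP => // h.
case/eqP: m1; apply: cmP_eq => w; rewrite cm1.
by have [->|/h] := eqVneq w v.
Qed.

(* The substitution of [s v] for each variable [v], where [s] is a bijection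
   with inverse [t]. *)
Definition rename (s t : I -> I) f : fps I :=
  FPS (fun m => coef f (mcomp s t m)).

Lemma rename_X s t v : cancel s t -> cancel t s ->
  rename s t (fpsX v) = fpsX (s v).
Proof.
move=> st ts; apply: fpsP => m.
rewrite [LHS]/= [LHS]coefX [RHS]coefX.
suff -> : (mcomp s t m == ucm v) = (m == ucm (s v)) by [].
apply/eqP/eqP => [mv|->]; apply: cmP_eq => w.
  by rewrite -[w]ts -(mcompE m (t w) st) mv !cmU (can_eq st).
by rewrite mcompE // !cmU (can_eq st).
Qed.

Lemma renameB s t f g : rename s t (f - g) = rename s t f - rename s t g.
Proof. exact: fpsP. Qed.

Lemma rename1 s t : cancel s t -> cancel t s -> rename s t 1 = 1.
Proof.
move=> st ts; apply: fpsP => m; rewrite /= !coef1.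
suff -> : (mcomp s t m == mone) = (m == mone) by [].
apply/eqP/eqP => [mv|->]; apply: cmP_eq => w.
  by rewrite -[w]ts -(mcompE m (t w) st) mv !cm1.
by rewrite mcompE // !cm1.
Qed.

Lemma renameM s t f g : cancel s t -> cancel t s ->
  rename s t (f * g) = rename s t f * rename s t g.
Proof.
move=> st ts; apply: fpsP => m.
have [S uS hS] := mdivisors_seq m.
have cK : cancel (mcomp s t) (mcomp t s).
  by move=> d; apply: cmP_eq => v; rewrite !mcompE // ts.
have cM d e : mmul (mcomp s t d) (mcomp s t e) = mcomp s t (mmul d e).
  by apply: cmP_eq => v; rewrite cmM !mcompE // cmM.
have kc : cancel (mcomp t s) (mcomp s t).
  by move=> d; apply: cmP_eq => v; rewrite !mcompE // st.
rewrite (coef_mul _ _ uS hS) [LHS]/=.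
rewrite -/(coef (fps_mul f g) _) (@coef_mul _ _ _ (map (mcomp s t) S)).
- rewrite big_map; apply: eq_bigr => d _; rewrite big_map.
  by apply: eq_bigr => e _; rewrite cM (can_eq cK).
- by rewrite map_inj_uniq //; exact: can_inj cK.
move=> d e dem.
have [|dS eS] := hS (mcomp t s d) (mcomp t s e).
  by apply: (can_inj cK); rewrite -cM !kc.
by rewrite -[d]kc -[e]kc !(mem_map (can_inj cK)).
Qed.

Lemma subX_reg u v f : u != v -> (fpsX u - fpsX v) * f = 0 -> f = 0.
Proof.
move=> uv; rewrite mulrBl => h.
suff P k m : m v = k -> coef f m = 0 by apply: fpsP => m; exact: P erefl.
elim: k m => [|k IH] m mv; set mu := mmul m (ucm u);
  have muu : (0 < mu u)%N by rewrite /mu cmM cmUU addn1.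
all: have muv : mu v = m v by rewrite /mu cmM cmU (negPf uv) addn0.
all: have muK : divcm mu (ucm u) = m
  by apply: cmP_eq => w; rewrite divcmE /mu cmM addnK.
all: move/(congr1 (fun g => coef g mu)): h; rewrite coefB.
all: rewrite [X in X - _]coefXM [X in _ - X]coefXM muu muK muv mv.
  by rewrite subr0.
by rewrite (IH (divcm mu (ucm v))) ?subr0 // divcmE muv mv cmUU subn1.
Qed.

Lemma subX_div u v s f : u != v -> involutive s -> s u = v ->
  (forall w, w != u -> w != v -> s w = w) ->
  rename s s f = - f -> exists g, (fpsX u - fpsX v) * g = f.
Proof.
move=> uv ss su sw fN; have vu : v != u by rewrite eq_sym.
have sv : s v = u by rewrite -su ss.
(* [mk m k] is [m * u ^ k / v ^ k] *)
pose mk m k := divcm (mmul m (iter k (mmul (ucm u)) mone))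
                     (iter k (mmul (ucm v)) mone).
have itE (x : I) k w : iter k (mmul (ucm x)) (mone : {cmonom I}) w
    = ((x == w) * k)%N.
  by elim: k => [|k IH] /=; rewrite ?cm1 ?muln0 // cmM IH cmU mulnS.
have mkE m k w : mk m k w = (m w + (u == w) * k - (v == w) * k)%N.
  by rewrite divcmE cmM !itE.
have fA m : coef f (mcomp s s m) = - coef f m.
  by move/(congr1 (fun g => coef g m)): fN.
have [g gE] : exists g, forall m, coef g m =
    \sum_(k < (m v).+1) coef f (mk (mmul m (ucm u)) k) by eexists (FPS _).
exists g; rewrite mulrBl; apply: fpsP => m.
rewrite coefB [X in X - _]coefXM [X in _ - X]coefXM.
have mk0 : mk m 0%N = m by apply: cmP_eq => w; rewrite mkE; lia.
have gv : (0 < m v)%N ->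
    coef g (divcm m (ucm v)) = \sum_(k < m v) coef f (mk m k.+1).
  move=> mv; rewrite gE; have -> : ((divcm m (ucm v)) v).+1 = m v.
    by rewrite divcmE cmUU subn1 prednK.
  apply: eq_bigr => k _; congr coef; apply: cmP_eq => w.
  rewrite !mkE cmM divcmE !cmU.
  by case: (eqVneq v w) => [<-|_]; case: (u == _); lia.
have [mu|] := ltnP 0%N (m u).
  have -> : coef g (divcm m (ucm u)) = \sum_(k < (m v).+1) coef f (mk m k).
    rewrite gE; have -> : divcm m (ucm u) v = m v by rewrite divcmE cmU (negPf uv) subn0.
    apply: eq_bigr => k _; congr coef; congr mk; apply: cmP_eq => w.
    by rewrite cmM divcmE cmU; case: (eqVneq u w) => [<-|_]; lia.
  rewrite big_ord_recl mk0; case: ifPn => [/gv ->|]; first by rewrite addrK.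
  by rewrite -eqn0Ngt => /eqP ->; rewrite big_ord0 addr0 subr0.
rewrite leqn0 => /eqP mu; rewrite sub0r.
have S0 : \sum_(k < (m v).+1) coef f (mk m k) = 0.
  suff /eqP : \sum_(k < (m v).+1) coef f (mk m k)
     = - \sum_(k < (m v).+1) coef f (mk m k).
    by rewrite -addr_eq0 -mulr2n mulrn_eq0 => /eqP.
  rewrite {1}(reindex_inj rev_ord_inj) /= -sumrN; apply: eq_bigr => k _.
  rewrite -fA; congr coef; apply: cmP_eq => w; rewrite mcompE // !mkE subSS.
  have kv := ltn_ord k.
  have [->|wu] := eqVneq w u.
    by rewrite su mu !eqxx ?(negPf uv) ?(negPf vu); lia.
  have [->|wv] := eqVneq w v.
    by rewrite sv mu !eqxx ?(negPf uv) ?(negPf vu); lia.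
  rewrite sw // ![_ == w]eq_sym (negPf wu) (negPf wv); lia.
move: S0; rewrite big_ord_recl mk0.
case: ifPn => [/gv -> /eqP|].
  by rewrite addrC addr_eq0 => /eqP ->; rewrite opprK.
by rewrite -eqn0Ngt => /eqP ->; rewrite big_ord0 addr0 oppr0.
Qed.

End PowerSeries.

(* The sum of a family of series is taken coefficientwise; it is meaningful
   when the family is summable. *)
Definition summable (I T : choiceType) (A : set T) (F : T -> fps I) :=
  forall m, finite_set [set t | A t /\ coef (F t) m != 0].
Definition fps_sum (I T : choiceType) (A : set T) (F : T -> fps I) : fps I :=
  FPS (fun m => \sum_(t \in A) coef (F t) m).

(* The index tends to minus infinity. *)
Definition fps_limit (I : choiceType) (F : int -> fps I) (G : fps I) :=
  forall m, exists P : int, forall p, p <= P -> coef (F p) m = coef G m.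

Definition SZ : set (int -> int) :=
  [set w : int -> int | bijective w /\ finite_set [set i | w i != i]].

Definition simple (i : int) : int -> int :=
  fun k => if k == i then i + 1 else if k == i + 1 then i else k.

Definition word (s : seq int) : int -> int :=
  foldr (fun i u => simple i \o u) id s.

Definition is_length (w : int -> int) (n : nat) :=
  (exists2 s, size s = n & word s = w) /\
  (forall s, word s = w -> (n <= size s)%N).
Definition len (w : int -> int) : nat := xget 0%N [set n | is_length w n].

(* The [k]-th power of the shift automorphism. *)
Definition gamma (k : int) (w : int -> int) : int -> int :=
  fun i => w (i - k) + k.

Lemma gamma_simple i : gamma 1 (simple i) = simple (i + 1).
Proof.
apply/funext => k; rewrite /gamma /simple subr_eq.
rewrite [k - 1 == i + 1]subr_eq; do 2![case: eqP => // _].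
by rewrite subrK.
Qed.

Lemma gammaM k u v : gamma k (u \o v) = gamma k u \o gamma k v.
Proof. by apply/funext => i; rewrite /gamma /= addrK. Qed.

Lemma gammaD k l w : gamma k (gamma l w) = gamma (k + l) w.
Proof.
apply/funext => i; rewrite /gamma -addrA [l + k]addrC.
by congr (w _ + _); rewrite opprD addrA.
Qed.

Lemma simpleK i : involutive (simple i).
Proof.
move=> k; rewrite /simple; have [->|ki] := eqVneq k i.
  by rewrite eqxx; case: eqP => //; lia.
have [->|ki1] := eqVneq k (i + 1); first by rewrite eqxx.
by rewrite (negPf ki) (negPf ki1).
Qed.

(* The variables: [inl i] is x_i and [inr j] is a_j. *)
Definition var : choiceType := (int + int)%type.
Definition x (i : int) : fps var := fpsX (inl i : var).
Definition a (j : int) : fps var := fpsX (inr j : var).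

Definition ominus (f g : fps var) : fps var := (f - g) / (1 - g).

Lemma unit_1suba j : 1 - a j \is a GRing.unit.
Proof. exact: unit_1subX. Qed.

Definition swapx_var (i : int) (v : var) : var :=
  match v with inl k => inl (simple i k) | inr k => inr k end.
Definition swapx (i : int) : fps var -> fps var :=
  rename (swapx_var i) (swapx_var i).

Lemma swapx_varK i : involutive (swapx_var i).
Proof. by case=> k //=; rewrite simpleK. Qed.

Lemma swapx_x i k : swapx i (x k) = x (simple i k).
Proof. by rewrite /swapx rename_X //; exact: swapx_varK. Qed.

Lemma swapx_a i k : swapx i (a k) = a k.
Proof. by rewrite /swapx rename_X //; exact: swapx_varK. Qed.

Lemma swapxB i f g : swapx i (f - g) = swapx i f - swapx i g.
Proof. exact: renameB. Qed.

Lemma swapxM i f g : swapx i (f * g) = swapx i f * swapx i g.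
Proof. by apply: renameM; exact: swapx_varK. Qed.

Lemma swapxK i : involutive (swapx i).
Proof.
move=> f; apply: fpsP => m /=; congr coef; apply: cmP_eq => v.
by rewrite !mcompE ?swapx_varK //; exact: swapx_varK.
Qed.

Definition tpi (i : int) (f : fps var) : fps var :=
  xget 0 [set g | (x i - x (i + 1)) * g =
                  (1 - x (i + 1)) * f - (1 - x i) * swapx i f].

Lemma tpiP i f :
  (x i - x (i + 1)) * tpi i f = (1 - x (i + 1)) * f - (1 - x i) * swapx i f.
Proof.
suff : exists g, (x i - x (i + 1)) * g =
    (1 - x (i + 1)) * f - (1 - x i) * swapx i f by move=> /(xgetPex 0).
have sK := @swapx_varK i.
have si : simple i i = i + 1 by rewrite /simple eqxx.
have si1 : simple i (i + 1) = i by rewrite -[in LHS]si simpleK.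
have xs k : swapx i (1 - x k) = 1 - x (simple i k).
  by rewrite swapxB swapx_x /swapx rename1.
apply: (@subX_div _ _ _ (swapx_var i)) => //.
- by apply/eqP => -[]; lia.
- by rewrite /= si.
- case=> k //= k1 k2; congr inl; rewrite /simple.
  have [ki|_] := eqVneq k i; first by rewrite ki eqxx in k1.
  by have [ki|_] := eqVneq k (i + 1); first by rewrite ki eqxx in k2.
rewrite -/(swapx i _) swapxB swapxM xs si1 [X in _ - X]swapxM xs si swapxK.
by rewrite opprB.
Qed.

Lemma tpi_uniq i f g :
  (x i - x (i + 1)) * g = (1 - x (i + 1)) * f - (1 - x i) * swapx i f ->
  g = tpi i f.
Proof.
rewrite -tpiP => /eqP; rewrite -subr_eq0 -mulrBr => /eqP h.
by apply/eqP; rewrite -subr_eq0; apply/eqP/(subX_reg _ h)/eqP => -[]; lia.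
Qed.

Definition w0 (n : nat) : int -> int :=
  fun i => if (1 <= i) && (i <= n%:Z) then n%:Z + 1 - i else i.

Definition groth_top (n : nat) : fps var :=
  \prod_(1 <= i < n.+1) \prod_(1 <= j < n.+1 | (i + j <= n)%N)
    ominus (x i%:Z) (a j%:Z).

(* [is_groth n w f]: [f] is obtained by descending from the longest element of
   [S_n] to [w]; [f] depends only on [w]. *)
Inductive is_groth (n : nat) : (int -> int) -> fps var -> Prop :=
| is_groth_top : is_groth n (w0 n) (groth_top n)
| is_groth_tpi (w : int -> int) (i : int) (f : fps var) :
    0 < i -> i < n%:Z -> (len w < len (w \o simple i))%N ->
    is_groth n (w \o simple i) f -> is_groth n w (tpi i f).

Definition groth (w : int -> int) : fps var :=
  xget 0 [set f | exists n, is_groth n w f].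

(* The substitution [x_i := x_{i+k}], [a_i := a_{i+k}]. *)
Definition shift_var (k : int) (v : var) : var :=
  match v with inl i => inl (i + k) | inr i => inr (i + k) end.
Definition shift (k : int) : fps var -> fps var :=
  rename (shift_var k) (shift_var (- k)).

Lemma shift_varK k : cancel (shift_var k) (shift_var (- k)).
Proof. by case=> i /=; rewrite addrK. Qed.

Lemma shift_varNK k : cancel (shift_var (- k)) (shift_var k).
Proof. by case=> i /=; rewrite subrK. Qed.

Lemma shift_x k i : shift k (x i) = x (i + k).
Proof.
by rewrite /shift rename_X //; [exact: shift_varK | exact: shift_varNK].
Qed.

Lemma shift_a k i : shift k (a i) = a (i + k).
Proof.
by rewrite /shift rename_X //; [exact: shift_varK | exact: shift_varNK].
Qed.

Definition bs_approx (w : int -> int) (p : int) : fps var :=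
  shift (p - 1) (groth (gamma (1 - p) w)).

Definition bs_groth (w : int -> int) : fps var :=
  xget 0 [set G | fps_limit (bs_approx w) G].

Lemma fps_limit_uniq (F : int -> fps var) G H :
  fps_limit F G -> fps_limit F H -> G = H.
Proof.
move=> FG FH; apply: fpsP => m; have [P hP] := FG m; have [Q hQ] := FH m.
rewrite -(hP (Order.min P Q)) ?ge_min ?lexx //.
by rewrite -(hQ (Order.min P Q)) // ge_min lexx orbT.
Qed.

Inductive tile := Empty | NW | SE | Horizontal | Vertical | Crossing.

HB.instance Definition _ := gen_eqMixin tile.
HB.instance Definition _ := gen_choiceMixin tile.

Definition north (t : tile) : bool :=
  match t with NW | Vertical | Crossing => true | _ => false end.
Definition south (t : tile) : bool :=
  match t with SE | Vertical | Crossing => true | _ => false end.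
Definition west (t : tile) : bool :=
  match t with NW | Horizontal | Crossing => true | _ => false end.
Definition east (t : tile) : bool :=
  match t with SE | Horizontal | Crossing => true | _ => false end.

(* Matrix coordinates: [D i j] is the tile in row [i] and column [j]. *)
Definition tiling := int -> int -> tile.

Definition matching (D : tiling) := forall i j,
  south (D i j) = north (D (i + 1) j) /\ east (D i j) = west (D i (j + 1)).

Definition hook (D : tiling) (N : int) :=
  [/\ D N N = SE,
      forall i, N < i -> D i N = Vertical \/ D i N = Crossing &
      forall j, N < j -> D N j = Horizontal \/ D N j = Crossing].

(* All pipes come from the south, one in each column, and leave to the east,
   one in each row. The hooks alone do not exclude a pipe crossing all of them,
   coming from the far west or leaving to the far north. *)
Definition south_to_east (D : tiling) :=
  [/\ forall j, exists R : int, forall i, R <= i -> south (D i j),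
      forall i, exists C : int, forall j, C <= j -> east (D i j),
      forall i, exists C : int, forall j, j <= C -> ~~ west (D i j) &
      forall j, exists R : int, forall i, i <= R -> ~~ north (D i j)].

Definition kbpd (D : tiling) :=
  [/\ matching D, exists M : int, forall N, M <= `|N| -> hook D N &
      south_to_east D].

(* Labelling of the pipes by the columns in which they enter from the south:
   [S i j] and [W i j] are the labels of the pipes through the south and west
   edges of [(i, j)]; those of the north and east edges are then [S (i - 1) j]
   and [W i (j + 1)]. Labels of edges without pipe are irrelevant. *)
Section Labels.
Variables (D : tiling) (S W : int -> int -> int).

(* The pipes [p] and [q] cross at [(i, j)], and this crossing is not ignored. *)
Definition cross_at (p q i j : int) :=
  [/\ D i j = Crossing,
      (W i j = p /\ S i j = q) \/ (W i j = q /\ S i j = p) &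
      S (i - 1) j = S i j /\ W i (j + 1) = W i j].

Definition already_crossed (p q i j : int) :=
  exists i' j', [/\ i <= i', j' <= j, (i', j') <> (i, j) & cross_at p q i' j'].

(* An ignored crossing is traversed as if the two pipes bounced off each other. *)
Definition follow (i j : int) : Prop :=
  match D i j with
  | Empty => True
  | NW => S (i - 1) j = W i j
  | SE => W i (j + 1) = S i j
  | Horizontal => W i (j + 1) = W i j
  | Vertical => S (i - 1) j = S i j
  | Crossing =>
      (already_crossed (W i j) (S i j) i j ->
         S (i - 1) j = W i j /\ W i (j + 1) = S i j) /\
      (~ already_crossed (W i j) (S i j) i j ->
         S (i - 1) j = S i j /\ W i (j + 1) = W i j)
  end.

Definition is_labelling :=
  (forall j, exists R : int, forall i, R <= i -> S i j = j) /\
  (forall i j, follow i j).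

End Labels.

(* [w(D) = w]: for each row [j], the pipe heading east in row [j] is the one
   entering from the south in column [w j]. *)
Definition has_perm (D : tiling) (w : int -> int) :=
  exists S W, is_labelling D S W /\
    forall j, exists C : int, forall c, C <= c -> W j c = w j.

Definition kbpd_of (w : int -> int) : set tiling :=
  [set D | kbpd D /\ has_perm D w].

(* Both sets are finite when [kbpd D]; the products are over finite supports. *)
Definition wt (D : tiling) : fps var :=
  (\big[*%R/1]_(p \in [set p : int * int | D p.1 p.2 = Empty])
     (- ominus (x p.1) (a p.2))) *
  (\big[*%R/1]_(p \in [set p : int * int | D p.1 p.2 = NW])
     (1 - ominus (x p.1) (a p.2))).

(* Main.v *)
(** Read the labels of the pipes along a lattice path from the north-west to the
    south-east corner of a box: a cell of the box replaces two adjacent letters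
    of this word, its west and south labels, by its north and east labels.
    Ignoring the crossings of pipes that have already crossed amounts to a local
    rule: at a crossing the larger label leaves north and the smaller one leaves
    east. So the sum over the pipe dreams is the partition function of a coloured
    vertex model, an edge without pipe counting as the largest label. The model
    is integrable: its vertex weights satisfy the Yang-Baxter equation with an
    R-matrix built from the sorting operator of the 0-Hecke algebra. Pushing the
    R-matrix through two adjacent rows gives the recursion by [tpi], and the
    longest element has a single pipe dream. Finally, a pipe dream that differs
    from straight hooks in row or column [p] at first has an empty cell at
    [(p, p)], so that its weight only has monomials divisible by [x_p] or [a_p];
    hence each coefficient stabilizes as the box grows to the north-west. *)

From HB Require Import structures.
From mathcomp Require Import all_boot all_order all_algebra.
From mathcomp Require Import finmap monalg boolp classical_sets.
From mathcomp Require Import cardinality fsbigop.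
From mathcomp Require Import zify ring.
Require Import Defs.

Set Implicit Arguments.
Unset Strict Implicit.
Unset Printing Implicit Defensive.

Import Order.TTheory GRing.Theory Num.Theory.

Local Open Scope classical_set_scope.
Local Open Scope ring_scope.

(** * The vertex model *)

(** With [X_i = 1 - x_i] and [C_j = 1 / (1 - a_j)], the cell weight is [1 - X_i C_j]. Thanks to this
    factorization the R-matrix depends on the row parameters alone, so a single one passes through
    all columns. At the west end it meets two edges without pipe and is the scalar [X_i]; at the
    east end it acts on two exit labels and mixes [w] with [w s_i]. Equating both ends gives, up to
    sign, the defining equation of [tpi], which has only one solution because [x_i - x_(i+1)] is not
    a zero divisor. The obstacle is that the rule on repeated crossings is global: whether a
    crossing counts depends on the history of both pipes. The word of labels starts increasing, and
    two pipes exchange places only when the smaller label stands on the left; so a larger label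
    stands left of a smaller one exactly when their pipes have already crossed. In the limit the two
    corners differ. To the south-east, [w] alone bounds the region where a pipe dream departs from
    hooks. To the north-west there is in general no common bound, and only the vanishing of
    coefficients gives one. *)

Lemma simple_l k : simple k k = k + 1.
Proof. by rewrite /simple eqxx. Qed.

Lemma simple_r k : simple k (k + 1) = k.
Proof. by rewrite -[in LHS]simple_l simpleK. Qed.

Lemma simple_out k l : l != k -> l != k + 1 -> simple k l = l.
Proof. by rewrite /simple => /negPf -> /negPf ->. Qed.

Notation label := (option int).
Notation lword := (int -> option int).

(* [None] marks an edge without pipe; it behaves as the largest label. *)
Definition ltl (c d : label) : bool :=
  match c, d with
  | Some i, Some j => i < j
  | Some _, None => true
  | None, _ => false
  end.

Section Operators.
Variable R : comNzRingType.
Implicit Types (A B : label -> label -> R) (F G : lword -> R) (v : lword).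
Implicit Types (i j k l p r : int) (m n : nat) (w : int -> int).

Definition locop A B (k : int) F : lword -> R := fun v =>
  A (v k) (v (k + 1)) * F v + B (v k) (v (k + 1)) * F (v \o simple k).

(* The vertex operator: the west and south labels of a cell are replaced by
   its north and east labels; [u] is the weight [x (-) a] of the cell. *)
Definition vertA (u : R) (c d : label) : R :=
  match c, d with
  | None, None => - u
  | Some _, None => 1 - u
  | None, Some _ => 1
  | Some i, Some j => if i < j then 0 else 1
  end.
Definition vertB (c d : label) : R :=
  match c, d with
  | None, None => 0
  | Some i, Some j => if i < j then 1 else 0
  | _, _ => 1
  end.
Definition vert u := locop (vertA u) vertB.

(* The R-matrix is [X + (Y - X) pi], with [pi] the 0-Hecke sorting operator,
   except that [pi] kills a pair of edges without pipe. *)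
Definition rmatA (X Y : R) (c d : label) : R :=
  match c, d with
  | None, None => X
  | Some _, None => X
  | None, Some _ => Y
  | Some i, Some j => if i < j then X else Y
  end.
Definition rmatB (X Y : R) (c d : label) : R := (Y - X) * (ltl c d)%:R.
Definition rmat X Y := locop (rmatA X Y) (rmatB X Y).

Lemma simple_far k l i : k + 1 < l -> simple k (simple l i) = simple l (simple k i).
Proof.
move=> kl; rewrite /simple; repeat case: eqP; lia.
Qed.

Lemma locop_far A B A' B' k l F : k + 1 < l ->
  locop A B k (locop A' B' l F) = locop A' B' l (locop A B k F).
Proof.
move=> kl; apply/funext => v; rewrite /locop /=.
rewrite !(@simple_out k) ?(@simple_out l); try (apply/eqP; lia).
have -> : (v \o simple k) \o simple l = (v \o simple l) \o simple k.
  by apply/funext => i /=; rewrite simple_far.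
ring.
Qed.

(** Operators at [k] and [k + 1] only permute three consecutive letters, so all words in the
    Yang-Baxter equation have this form. *)
Definition put3 v (k : int) (a b c : label) : lword := fun l =>
  if l == k then a else if l == k + 1 then b else if l == k + 1 + 1 then c
  else v l.

Lemma put3_id v k : put3 v k (v k) (v (k + 1)) (v (k + 1 + 1)) = v.
Proof. by apply/funext => l; rewrite /put3; do !case: eqP => [->|_]. Qed.

Lemma put3_1 v k a b c : put3 v k a b c k = a.
Proof. by rewrite /put3 eqxx. Qed.
Lemma put3_2 v k a b c : put3 v k a b c (k + 1) = b.
Proof. by rewrite /put3 eqxx; case: eqP => //; lia. Qed.
Lemma put3_3 v k a b c : put3 v k a b c (k + 1 + 1) = c.
Proof. by rewrite /put3 eqxx; do 2![case: eqP => //; try lia]. Qed.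

Lemma put3_swap1 v k a b c : put3 v k a b c \o simple k = put3 v k b a c.
Proof.
apply/funext => l; rewrite /put3 /simple /=.
by repeat (case: eqP => //; try lia).
Qed.

Lemma put3_swap2 v k a b c : put3 v k a b c \o simple (k + 1) = put3 v k a c b.
Proof.
apply/funext => l; rewrite /put3 /simple /=.
by repeat (case: eqP => //; try lia).
Qed.

(** The operators see labels only through comparisons. For each order pattern of three labels this
    is a polynomial identity in [X], [Y], [C] and the values of [F] at the permuted words. *)
Lemma yang_baxter (X Y C : R) k F :
  vert (1 - Y * C) (k + 1) (vert (1 - X * C) k (rmat X Y (k + 1) F)) =
  rmat X Y k (vert (1 - X * C) (k + 1) (vert (1 - Y * C) k F)).
Proof.
apply/funext => v; rewrite -[v](@put3_id v k).
move: (v k) (v (k + 1)) (v (k + 1 + 1)) => a b c; rewrite /vert /rmat /locop.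
rewrite !(put3_1, put3_2, put3_3, put3_swap1, put3_swap2).
case: a b c => [a|] [b|] [c|]; rewrite /vertA /vertB /rmatA /rmatB /ltl;
  try (case: (ltgtP a b) => [ab|ab|ab]); try (case: (ltgtP a c) => [ac|ac|ac]);
  try (case: (ltgtP b c) => [bc|bc|bc]); try lia; subst;
  rewrite /= ?ltxx /=; ring.
Qed.

Definition rowcells (p r : int) (m : nat) : seq (int * int) :=
  [seq (r, p + h%:Z) | h <- iota 0 m].

(* The cells of the rows [p, ..., p + m - 1], from the bottom row upwards. *)
Fixpoint gridcells (p : int) (n m : nat) : seq (int * int) :=
  if m is m'.+1 then rowcells p (p + m'%:Z) n ++ gridcells p n m' else [::].

Lemma rowcellsP p r m (c : int * int) :
  reflect (c.1 = r /\ p <= c.2 < p + m%:Z) (c \in rowcells p r m).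
Proof.
case: c => i j /=; apply: (iffP mapP) => [[k] | [-> jm]].
  by rewrite mem_iota => km [-> ->]; split => //; lia.
exists `|j - p|%N; first by rewrite mem_iota; lia.
by congr pair; lia.
Qed.

Lemma gridcellsP p n m (c : int * int) : reflect
  (p <= c.1 < p + m%:Z /\ p <= c.2 < p + n%:Z) (c \in gridcells p n m).
Proof.
elim: m => [|m IH] /=; first by apply: (iffP idP) => //; lia.
rewrite mem_cat; apply: (iffP orP) => [[/rowcellsP|/IH]|]; try lia.
move=> h; have [cm|cm] := eqVneq c.1 (p + m%:Z).
  by left; apply/rowcellsP; lia.
by right; apply/IH; lia.
Qed.

Lemma gridcells_uniq p n m : uniq (gridcells p n m).
Proof.
elim: m => //= m IH; rewrite cat_uniq IH andbT; apply/andP; split.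
  by rewrite map_inj_uniq ?iota_uniq // => a b []; lia.
by apply/hasPn => c /gridcellsP cg; apply/negP => /rowcellsP; lia.
Qed.

Lemma rowcellsS p r m : rowcells p r m.+1 = rcons (rowcells p r m) (r, p + m%:Z).
Proof. by rewrite /rowcells -addn1 iotaD map_cat /= add0n cats1. Qed.

(* The index in the word of the west label of a cell; its south label follows. *)
Definition cpos (c : int * int) : int := c.1 + c.2 - 1.

Implicit Types (X C : int -> R) (c d : int * int) (cs : seq (int * int)).

Definition evalc X C cs F : lword -> R :=
  foldr (fun c G => vert (1 - X c.1 * C c.2) (cpos c) G) F cs.

Lemma evalc_cat X C cs cs' F :
  evalc X C (cs ++ cs') F = evalc X C cs (evalc X C cs' F).
Proof. exact: foldr_cat. Qed.

Lemma evalc_rcons X C cs c F :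
  evalc X C (rcons cs c) F =
  evalc X C cs (vert (1 - X c.1 * C c.2) (cpos c) F).
Proof. by rewrite -cats1 evalc_cat. Qed.

Lemma eq_evalc X X' C cs F : {in cs, forall c, X c.1 = X' c.1} ->
  evalc X C cs F = evalc X' C cs F.
Proof.
elim: cs => //= c cs IH h; rewrite h ?mem_head // IH // => d dcs.
by apply: h; rewrite inE dcs orbT.
Qed.

Lemma evalc_lt X C cs A B k F : {in cs, forall c, cpos c + 1 < k} ->
  evalc X C cs (locop A B k F) = locop A B k (evalc X C cs F).
Proof.
elim: cs => //= c cs IH h; rewrite IH => [|d dcs]; last first.
  by apply: h; rewrite inE dcs orbT.
by rewrite [LHS]locop_far // h ?mem_head.
Qed.

Lemma evalc_gt X C cs A B k F : {in cs, forall c, k + 1 < cpos c} ->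
  evalc X C cs (locop A B k F) = locop A B k (evalc X C cs F).
Proof.
elim: cs => //= c cs IH h; rewrite IH => [|d dcs]; last first.
  by apply: h; rewrite inE dcs orbT.
by rewrite [RHS]locop_far // h ?mem_head.
Qed.

Lemma evalc_linear X C cs (a b : R) F G v :
  evalc X C cs (fun u => a * F u + b * G u) v =
  a * evalc X C cs F v + b * evalc X C cs G v.
Proof. by elim: cs v => //= c cs IH v; rewrite /vert /locop !IH; ring. Qed.

(** Induction on the number of columns. The lower cell of the last column commutes with the earlier
    cells of the upper row ([far]), which makes the two cells of that column adjacent for
    [yang_baxter]. *)
Lemma two_rows X C p r m F :
  evalc X C (rowcells p (r + 1) m ++ rowcells p r m)
    (rmat (X r) (X (r + 1)) (r + p + m%:Z - 1) F) =
  rmat (X r) (X (r + 1)) (r + p - 1)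
    (evalc (X \o simple r) C (rowcells p (r + 1) m ++ rowcells p r m) F).
Proof.
have far X' m' u G : evalc X' C (rowcells p r m') (vert u (cpos (r + 1, p + m'%:Z)) G)
    = vert u (cpos (r + 1, p + m'%:Z)) (evalc X' C (rowcells p r m') G).
  by apply: evalc_lt => c /rowcellsP; rewrite /cpos /=; lia.
elim: m F => [|m IH] F; first by rewrite addr0.
rewrite !rowcellsS !evalc_cat !evalc_rcons.
rewrite -(far X m) -(far (X \o simple r) m) -!evalc_cat /= simple_l simple_r /cpos /=.
have -> : r + 1 + (p + m%:Z) - 1 = r + p + m%:Z - 1 + 1 by lia.
have -> : r + (p + m%:Z) - 1 = r + p + m%:Z - 1 by lia.
have -> : r + p + m.+1%:Z - 1 = r + p + m%:Z - 1 + 1 by lia.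
by rewrite yang_baxter IH.
Qed.

(** Rows above [r] act left of the east edges of rows [r] and [r + 1], and rows below [r + 1] act
    right of their west edges; the R-matrix commutes with both kinds. *)
Lemma grid_exchange X C p n m r F : p <= r -> r + 1 < p + m%:Z ->
  evalc X C (gridcells p n m)
    (rmat (X r) (X (r + 1)) (r + p + n%:Z - 1) F) =
  rmat (X r) (X (r + 1)) (r + p - 1)
    (evalc (X \o simple r) C (gridcells p n m) F).
Proof.
move=> pr; elim: m F => [|m IH] F; first by lia.
move=> rm /=; have [rm'|rm'] := ltrP (r + 1) (p + m%:Z).
  rewrite evalc_cat IH // evalc_gt => [|c /rowcellsP]; last first.
    by rewrite /cpos; lia.
  rewrite evalc_cat; congr (locop _ _ _ _); apply: eq_evalc => c /rowcellsP[-> _] /=.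
  by rewrite simple_out //; apply/eqP; lia.
case: m {IH} rm rm' => [|m] rm rm'; first by lia.
have -> : p + m.+1%:Z = r + 1 by lia.
have rE : r = p + m%:Z by lia.
rewrite /= -rE catA evalc_cat evalc_lt => [|c /gridcellsP]; last first.
  by rewrite /cpos; lia.
rewrite two_rows [in RHS]evalc_cat; congr (rmat _ _ _ (evalc _ _ _ _)).
apply: eq_evalc => c /gridcellsP /= h.
by rewrite simple_out //; apply/eqP; lia.
Qed.

Definition ind (u : lword) : lword -> R := fun v => if `[< v = u >] then 1 else 0.

(* The labels along the west and south boundary of the box with rows and
   columns [p, ..., p + n - 1] for [w = id], and along its north and east
   boundary when the pipe leaving in row [i] is [w i]. *)
Definition bword (p : int) (n : nat) (w : int -> int) : lword := fun k =>
  if p + p + n%:Z - 1 <= k then Some (w (k - (p + n%:Z - 1))) else None.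

Lemma bword_simple p n w i : p <= i ->
  bword p n w \o simple (i + (p + n%:Z - 1)) = bword p n (w \o simple i).
Proof.
move=> pi; apply/funext => k; rewrite /bword /= /simple.
do ![case: eqP => ?]; do ?case: ifP => ?; try lia; by [|congr (Some (w _)); lia].
Qed.

(** The exit word of [w \o simple i] has a descent at the two positions concerned, where the
    diagonal entry is [Y]; the off-diagonal entry leads to it from the ascent, the exit word of
    [w]. *)
Lemma rmat_ind p n w (i : int) (X Y : R) : p <= i -> w i < w (i + 1) ->
  rmat X Y (i + p + n%:Z - 1) (ind (bword p n (w \o simple i))) =
  fun v => Y * ind (bword p n (w \o simple i)) v
           + (Y - X) * ind (bword p n w) v.
Proof.
move=> pi wi; rewrite -bword_simple //; set k := i + (p + _ - 1).
have -> : i + p + n%:Z - 1 = k by rewrite /k; lia.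
apply/funext => v; set u := bword p n w.
have uk : u k = Some (w i).
  by rewrite /u /bword /k ifT; [congr (Some (w _)); lia | lia].
have uk1 : u (k + 1) = Some (w (i + 1)).
  by rewrite /u /bword /k ifT; [congr (Some (w _)); lia | lia].
have sK (t : lword) : (t \o simple k) \o simple k = t.
  by apply/funext => l /=; rewrite simpleK.
rewrite /rmat /locop /ind.
have -> : `[< v \o simple k = u \o simple k >] = `[< v = u >].
  apply: asbool_equiv_eq; split => [|-> //].
  by move=> /(congr1 (fun t => t \o simple k)); rewrite !sK.
case: asboolP => [->|_]; case: asboolP => [E|_].
- by move: (congr1 (fun t => t k) E); rewrite /= simple_l uk uk1 => -[]; lia.
- rewrite /= simple_l simple_r uk uk1 /rmatA (ltNge (w (i + 1))) ltW //=.
  by rewrite !mulr0 !addr0.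
- by rewrite E uk uk1 /rmatA /rmatB /= wi !mulr0 !mulr1.
- by rewrite !mulr0.
Qed.

Definition pfun X C p n w : R :=
  evalc X C (gridcells p n n) (ind (bword p n w)) (bword p n id).

(** This is [grid_exchange] at the entry word, where no pipe enters rows [i] and [i + 1] from the
    west and the R-matrix reduces to [X i]. *)
Lemma pfun_exchange X C p n w i :
  p <= i -> i + 1 < p + n%:Z -> w i < w (i + 1) ->
  (X (i + 1) - X i) * pfun X C p n w =
  X i * pfun (X \o simple i) C p n (w \o simple i)
  - X (i + 1) * pfun X C p n (w \o simple i).
Proof.
move=> pi ip wi; rewrite /pfun.
have := congr1 (fun G => G (bword p n id))
  (grid_exchange X C n (ind (bword p n (w \o simple i))) pi ip).
rewrite rmat_ind // evalc_linear => h.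
rewrite [X in _ = X - _](_ : _ = X (i + 1) * evalc X C (gridcells p n n)
    (ind (bword p n (w \o simple i))) (bword p n id) + (X (i + 1) - X i) *
    evalc X C (gridcells p n n) (ind (bword p n w)) (bword p n id)); first by ring.
rewrite h /rmat /locop /bword !ifF; [|lia|lia].
by rewrite /rmatB /= mulr0 mul0r addr0.
Qed.

End Operators.

(** * Lengths and inversions *)

Definition in_box (p : int) (n : nat) (w : int -> int) :=
  forall i, ~~ (p <= i < p + n%:Z) -> w i = i.

Definition inversions (w : int -> int) : set (int * int) :=
  [set c | c.1 < c.2 /\ w c.2 < w c.1].
Definition ninv (w : int -> int) : nat := #|` fset_set (inversions w)|.

Section Length.
Implicit Types (w : int -> int) (i j k p : int) (n : nat) (s : seq int).

(** A value outside the box is fixed, hence has itself as its only preimage. *)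
Lemma in_box_stable p n w i : injective w -> in_box p n w ->
  p <= i < p + n%:Z -> p <= w i < p + n%:Z.
Proof.
move=> wI wb ip; have [//|wp] := boolP (p <= w i < p + n%:Z).
by move: (wb _ wp) => /wI wi; rewrite wi ip in wp.
Qed.

Lemma SZ_in_box w : SZ w -> exists p n, in_box p n w.
Proof.
(* The sum of the absolute values of the moved points bounds each of them. *)
move=> [_ fw]; pose B := \sum_(i <- fset_set [set i | w i != i]) `|i|%N.
exists (- B%:Z), B.*2.+1 => i iB; apply/eqP; apply: contraTT iB => wi.
have iB : (`|i| <= B)%N.
  rewrite /B (big_fsetD1 i) /=; first exact: leq_addr.
  by rewrite in_fset_set // inE.
by rewrite negbK; lia.
Qed.

Lemma inversions_sub p n w : injective w -> in_box p n w ->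
  inversions w `<=` [set` gridcells p n n].
Proof.
move=> wI wb [i j] [/= ij wji]; apply/gridcellsP => /=.
have st := in_box_stable wI wb.
by have [ip|ip] := boolP (p <= i < p + n%:Z); have [jp|jp] := boolP (p <= j < p + n%:Z);
  move: wji; rewrite ?(wb _ ip) ?(wb _ jp); try move: (st _ ip); try move: (st _ jp); lia.
Qed.

Lemma finite_inversions w : SZ w -> finite_set (inversions w).
Proof.
move=> wS; have [p [n wb]] := SZ_in_box wS; case: wS => wB _.
by apply: sub_finite_set (inversions_sub (bij_inj wB) wb) _; exact: finite_seq.
Qed.

(** A crude ceiling, which makes the upward induction of [is_groth_exists] terminate. *)
Lemma ninv_le p n w : injective w -> in_box p n w ->
  (ninv w <= size (gridcells p n n))%N.
Proof.
move=> wI wb; apply: uniq_leq_size; first exact: fset_uniq.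
move=> c; have sub := inversions_sub wI wb.
rewrite in_fset_set; first by rewrite inE => /sub.
by apply: sub_finite_set sub _; exact: finite_seq.
Qed.

Lemma simple_bij i : bijective (simple i).
Proof. by exists (simple i); exact: simpleK. Qed.

Lemma SZ_simple w i : SZ w -> SZ (w \o simple i).
Proof.
move=> [wB wf]; split; first exact: bij_comp wB (simple_bij i).
apply: (@sub_finite_set _ _ ([set i; i + 1] `|` [set j | w j != j])).
  move=> j /=; have [->|ji] := eqVneq j i; first by left; left.
  have [->|ji1] := eqVneq j (i + 1); first by left; right.
  by rewrite simple_out //; right.
by rewrite finite_setU.
Qed.

Lemma SZ_id : SZ id.
Proof.
split; first by exists id.
by rewrite (_ : mkset _ = set0) // -subset0 => i /=; rewrite eqxx.
Qed.

Lemma comp_simpleK w i : (w \o simple i) \o simple i = w.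
Proof. by apply/funext => j /=; rewrite simpleK. Qed.

(** [simple i] keeps the order of every pair except [(i, i + 1)], which becomes the one new
    inversion. *)
Lemma ninv_asc w i : SZ w -> w i < w (i + 1) ->
  ninv (w \o simple i) = (ninv w).+1.
Proof.
move=> wS wi; pose f (c : int * int) := (simple i c.1, simple i c.2).
have fI : injective f.
  by move=> [a b] [a' b'] [/(can_inj (@simpleK i)) -> /(can_inj (@simpleK i)) ->].
have lts a b : a < b -> (a, b) != (i, i + 1) -> simple i a < simple i b.
  by rewrite xpair_eqE /simple; repeat case: eqP => //=; lia.
have E : inversions (w \o simple i) = (i, i + 1) |` (f @` inversions w).
  apply/seteqP; split => [[a b] [/= ab wab]|_ [->|[[a b] [/= ab wab] <-]]].
  - have [->|ne] := eqVneq (a, b) (i, i + 1); first by left.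
    right; exists (f (a, b)); last by rewrite /f /= !simpleK.
    by split => //=; apply: lts.
  - by split; rewrite /= ?simple_l ?simple_r //; lia.
  - split; rewrite /= ?simpleK //; apply: lts => //.
    by apply/eqP => -[ai bi]; move: wab; rewrite ai bi; lia.
have fin := finite_inversions wS.
rewrite /ninv E fset_setU1; last exact: finite_image.
rewrite fset_set_image // cardfsU1 card_imfset //=.
case: imfsetP => // -[[a b] /=]; rewrite in_fset_set // inE => -[/= ab _].
by move=> [ia ib]; exfalso; move: ab ia ib; rewrite /simple; do !case: eqP; lia.
Qed.

Lemma SZ_ltgt w i : SZ w -> {w i < w (i + 1)} + {w (i + 1) < w i}.
Proof.
move=> [/bij_inj wI _]; case: (ltgtP (w i) (w (i + 1))) => h; [by left|by right|].
by have := wI _ _ h; lia.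
Qed.

Lemma ninv_desc w i : SZ w -> w (i + 1) < w i ->
  ninv w = (ninv (w \o simple i)).+1.
Proof.
move=> wS wi; rewrite -(@ninv_asc (w \o simple i) i) ?comp_simpleK //; first exact: SZ_simple.
by rewrite /= simple_l simple_r.
Qed.

(** Growth by at least one per step from the fixed point [p - 1] gives [w i >= i]; growth up to the
    fixed point [p + n] gives [w i <= i]. *)
Lemma SZ_monotone w : SZ w -> (forall i, w i < w (i + 1)) -> w = id.
Proof.
move=> wS wm; have [p [n wb]] := SZ_in_box wS.
have up i (h : nat) : w i + h%:Z <= w (i + h%:Z).
  elim: h => [|h IH]; first by rewrite !addr0.
  have := wm (i + h%:Z); rewrite (_ : i + h%:Z + 1 = i + h.+1%:Z); lia.
apply/funext => i; have [ip|/wb //] := boolP (p <= i < p + n%:Z).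
have := up (p - 1) (absz (i - (p - 1))%R); have := up i (absz (p + n%:Z - i)%R).
rewrite (_ : p - 1 + _ = i); last by lia.
rewrite (_ : i + _ = p + n%:Z); last by lia.
by rewrite (wb (p - 1)) ?(wb (p + n%:Z)); lia.
Qed.

Lemma SZ_descent w : SZ w -> w <> id -> exists i, w (i + 1) < w i.
Proof.
move=> wS wid; apply: contrapT => h; apply: wid; apply: SZ_monotone => // i.
by case: (SZ_ltgt i wS) => // wi; case: h; exists i.
Qed.

Lemma word_rcons s i : word (rcons s i) = word s \o simple i.
Proof. by elim: s => //= j s ->. Qed.

Lemma word_SZ s : SZ (word s).
Proof.
by elim/last_ind: s => [|s i IH]; [exact: SZ_id|rewrite word_rcons; exact: SZ_simple].
Qed.

Lemma ninv_id : ninv id = 0%N.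
Proof.
rewrite /ninv (_ : inversions id = set0) ?fset_set0 //.
by rewrite -subset0 => c [] /=; lia.
Qed.

Lemma ninv_word s : (ninv (word s) <= size s)%N.
Proof.
elim/last_ind: s => [|s i IH]; first by rewrite /= ninv_id.
rewrite word_rcons size_rcons; case: (SZ_ltgt i (word_SZ s)) => wi.
  by rewrite ninv_asc //; exact: word_SZ.
by rewrite (ninv_desc (word_SZ s) wi) in IH; lia.
Qed.

(** Each letter of a word adds at most one inversion; conversely, removing descents one at a time
    produces a word with [ninv w] letters. *)
Lemma len_ninv w : SZ w -> len w = ninv w.
Proof.
move=> wS; have L : is_length w (ninv w).
  split => [|s <-]; last exact: ninv_word.
  move: {2}(ninv w) (erefl (ninv w)) => m; elim: m w wS => [|m IH] w wS wm.
    exists [::] => //; apply/esym; apply: contrapT => /(SZ_descent wS) [i].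
    by move=> /(ninv_desc wS); rewrite wm.
  have [wid|/eqP wid] := eqVneq w id; first by rewrite wid ninv_id in wm.
  have [i wi] := SZ_descent wS wid.
  have [|s ss sw] := IH _ (SZ_simple i wS).
    by have := ninv_desc wS wi; lia.
  exists (rcons s i); first by rewrite size_rcons ss (ninv_desc wS wi).
  by rewrite word_rcons sw comp_simpleK.
rewrite /len; case: xgetP => [m ->|/(_ _ L)] // -[[s <- sw] m_min].
case: L => -[s' s's s'w] nmin; apply/eqP.
by rewrite eqn_leq -{1}s's m_min //= nmin.
Qed.

Lemma len_lt w i : SZ w -> (len w < len (w \o simple i))%N = (w i < w (i + 1)).
Proof.
move=> wS; rewrite !len_ninv //; last exact: SZ_simple.
case: (SZ_ltgt i wS) => wi; first by rewrite ninv_asc // wi ltnSn.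
by rewrite (ninv_desc wS wi) ltnNge ltnW //= ltNge ltW.
Qed.

Lemma len_asc w i : SZ w -> w i < w (i + 1) -> len (w \o simple i) = (len w).+1.
Proof.
by move=> wS wi; rewrite !len_ninv ?ninv_asc //; exact: SZ_simple.
Qed.

Lemma in_box_SZ p n w : bijective w -> in_box p n w -> SZ w.
Proof.
move=> wB wb; split => //;
apply: (@sub_finite_set _ _ [set` [seq c.1 | c <- gridcells p n n]]).
  move=> i /= wi; have ip : p <= i < p + n%:Z.
    by apply: contraNT wi => /wb ->.
  by apply/mapP; exists (i, i) => //; apply/gridcellsP.
exact: finite_seq.
Qed.

Lemma in_box_simple p n w i : in_box p n w -> p <= i -> i + 1 < p + n%:Z ->
  in_box p n (w \o simple i).
Proof.
move=> wb pi ip j jp /=; rewrite simple_out ?wb //; apply/eqP; lia.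
Qed.

Lemma gammaK k w : gamma (- k) (gamma k w) = w.
Proof. by rewrite gammaD addNr; apply/funext => i; rewrite /gamma subr0 addr0. Qed.

Lemma gamma_bij k w : bijective w -> bijective (gamma k w).
Proof.
move=> [v wK vK]; exists (gamma k v) => i; rewrite /gamma addrK.
  by rewrite wK subrK.
by rewrite vK subrK.
Qed.

Lemma gamma_in_box k p n w : in_box p n w -> in_box (p + k) n (gamma k w).
Proof. by move=> wb i ip; rewrite /gamma wb ?subrK //; lia. Qed.

Lemma gamma_k_simple k i : gamma k (simple i) = simple (i + k).
Proof.
by apply/funext => j; rewrite /gamma /simple; repeat case: eqP; lia.
Qed.

Lemma len_gamma k w : SZ w -> len (gamma k w) = len w.
Proof.
move=> wS; have [p [n wb]] := SZ_in_box wS.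
have gS : SZ (gamma k w).
  by apply: in_box_SZ (gamma_in_box wb); apply: gamma_bij; case: wS.
rewrite !len_ninv // /ninv.
pose f (c : int * int) := (c.1 + k, c.2 + k).
have -> : inversions (gamma k w) = f @` inversions w.
  apply/seteqP; split => [[a b] [/= ab]|_ [[a b] [/= ab wab] <-]].
    rewrite /gamma => wab; exists (a - k, b - k); last by rewrite /f /= !subrK.
    by split => /=; lia.
  by split; rewrite /= /gamma ?addrK; lia.
rewrite fset_set_image; last exact: finite_inversions.
by rewrite card_imfset // => -[a b] [a' b'] [/addIr -> /addIr ->].
Qed.

Lemma w0K n : involutive (w0 n).
Proof. by move=> i; rewrite /w0; do !case: ifP; lia. Qed.

Lemma w0_in_box n : in_box 1 n (w0 n).
Proof. by move=> i ip; rewrite /w0 ifF //; lia. Qed.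

Lemma is_groth_box n w f : is_groth n w f -> bijective w /\ in_box 1 n w.
Proof.
elim=> [|v i g i0 iN _ _ [vB vb]].
  by split; [exists (w0 n); exact: w0K|exact: w0_in_box].
rewrite -(comp_simpleK v i); split; first exact: bij_comp vB (simple_bij i).
by apply: in_box_simple vb _ _; lia.
Qed.

(** Without ascent, [w] drops by at least one per step between values in [1..n]; this leaves room
    only for drops of exactly one. *)
Lemma w0_or_ascent n w : bijective w -> in_box 1 n w ->
  w = w0 n \/ exists2 i, 0 < i < n%:Z & w i < w (i + 1).
Proof.
move=> wB wb; have wS := in_box_SZ wB wb.
have [?|h] := pselect (exists2 i : int, 0 < i < n%:Z & w i < w (i + 1)); first by right.
left; have desc i : 0 < i < n%:Z -> w (i + 1) < w i.
  by move=> ip; case: (SZ_ltgt i wS) => // wi; case: h; exists i.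
have dn i (h' : nat) : 0 < i -> i + h'%:Z <= n%:Z -> w (i + h'%:Z) + h'%:Z <= w i.
  move=> i0; elim: h' => [|m IH] im; first by rewrite !addr0.
  have := desc (i + m%:Z); rewrite (_ : i + m%:Z + 1 = i + m.+1%:Z); lia.
apply/funext => i; rewrite /w0; case: ifP => ip; last by rewrite wb //; lia.
have st j : 1 <= j < 1 + n%:Z -> 1 <= w j < 1 + n%:Z.
  exact: in_box_stable (bij_inj wB) wb.
have := dn i (absz (n%:Z - i)%R); have := dn 1 (absz (i - 1)%R).
have -> : 1 + (absz (i - 1)%R)%:Z = i by lia.
have -> : i + (absz (n%:Z - i)%R)%:Z = n%:Z by lia.
by have := st 1; have := st n%:Z; lia.
Qed.

(** Climbing along ascents raises [ninv], which is bounded by [ninv_le], and can only stop at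
    [w0 n]. *)
Lemma is_groth_exists n w : bijective w -> in_box 1 n w ->
  exists f, is_groth n w f.
Proof.
move: (leqnn (size (gridcells 1 n n) - ninv w)).
move: {2}(size _ - _)%N => m; elim: m w => [|m IH] w wm wB wb.
all: have [->|[i ip wi]] := w0_or_ascent wB wb;
  first by exists (groth_top n); exact: is_groth_top.
all: have wS := in_box_SZ wB wb; have sB := bij_comp wB (simple_bij i).
all: have sb : in_box 1 n (w \o simple i) by apply: (in_box_simple wb); lia.
all: have := ninv_le (bij_inj sB) sb; rewrite ninv_asc // => le.
  by lia.
have [|f gf] := IH _ _ sB sb; first by rewrite ninv_asc //; lia.
by exists (tpi i f); apply: is_groth_tpi gf; rewrite ?len_lt //; lia.
Qed.

(** The counted cells are those that index the factors of [groth_top], so the sign can be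
    distributed as one [-1] per factor. *)
Lemma ninv_w0 n : ninv (w0 n) =
  count (fun c => c.1 + c.2 < 1 + n%:Z) (gridcells 1 n n).
Proof.
pose f (c : int * int) := (c.1, 1 + n%:Z - c.2).
have -> : ninv (w0 n) = size [seq c <- gridcells 1 n n | c.1 + c.2 < 1 + n%:Z].
  rewrite /ninv.
  have -> : inversions (w0 n) =
      f @` [set` [seq c <- gridcells 1 n n | c.1 + c.2 < 1 + n%:Z]].
    apply/seteqP; split => [[a b] h|_ [[a b] /= + <-]].
      exists (a, 1 + n%:Z - b); last by rewrite /f /=; congr pair; lia.
      rewrite /= mem_filter; apply/andP; split.
        by case: h => /=; rewrite /w0; do !case: ifP; lia.
      by apply/gridcellsP; case: h => /=; rewrite /w0; do !case: ifP; lia.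
    rewrite mem_filter => /andP[/= ab /gridcellsP /= h].
    by split; rewrite /= /w0; do ?case: ifP; lia.
  rewrite fset_set_image; last exact: finite_seq.
  rewrite card_imfset; last by move=> [a b] [a' b'] [-> /= h]; congr pair; lia.
  apply/perm_size/uniq_perm; first exact: fset_uniq.
    exact/filter_uniq/gridcells_uniq.
  move=> c; rewrite in_fset_set; last exact: finite_seq.
  by apply/idP/idP => [/set_mem|/mem_set].
by rewrite size_filter.
Qed.

End Length.

(** * The longest element *)

Ltac word_cases :=
  repeat (case: ifP => ?); try (by exfalso; lia);
  try (first [done | congr Some; lia | congr (Some (_ _)); lia]).

Section LongestElement.
Variables (R : comNzRingType) (X C : int -> R).
Implicit Types (F G : lword -> R) (v : lword) (cs : seq (int * int)).

(** No cell of [cs] moves the letter at position [K]. *)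
Lemma evalc_frozen cs u v (K : int) :
  {in cs, forall c, cpos c + 1 < K} -> v K <> u K ->
  evalc X C cs (ind R u) v = 0.
Proof.
elim: cs v => [|c cs IH] v h vK /=.
  by rewrite /ind; case: asboolP => // vu; rewrite vu in vK.
have hc : cpos c + 1 < K by apply: h; rewrite mem_head.
have {}h d : d \in cs -> cpos d + 1 < K.
  by move=> dcs; apply: h; rewrite inE dcs orbT.
rewrite /vert /locop !IH //= ?mulr0 ?addr0 //.
by rewrite simple_out //; apply/eqP; lia.
Qed.

(** The cells only permute the letters at positions from [K] on, so a label missing there never
    appears there. *)
Lemma evalc_absent cs G v (K : int) (b : label) :
  {in cs, forall c, K <= cpos c} ->
  (forall u, (forall k, K <= k -> u k <> b) -> G u = 0) ->
  (forall k, K <= k -> v k <> b) -> evalc X C cs G v = 0.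
Proof.
move=> h G0; elim: cs v h => [|c cs IH] v h vb /=; first exact: G0.
have hc : K <= cpos c by apply: h; rewrite mem_head.
have {}h d : d \in cs -> K <= cpos d.
  by move=> dcs; apply: h; rewrite inE dcs orbT.
rewrite /vert /locop !IH //= ?mulr0 ?addr0 // => k kK; apply: vb.
by rewrite /simple; do ?case: eqP; lia.
Qed.

Variables (p : int) (n : nat) (w : int -> int).
Hypothesis w_rev : forall i : int, p <= i < p + n%:Z -> w i = p + p + n%:Z - 1 - i.
Hypothesis w_out : forall i : int, p + n%:Z <= i -> w i = i.

(* The word between the columns [p + h - 1] and [p + h] of row [r]. *)
Let rword (r : int) (h : nat) : lword := fun k =>
  if k < p + p + n%:Z - 1 then None
  else if k < r + p + h%:Z - 1 then Some (k + 1 - r)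
  else if k == r + p + h%:Z - 1 then Some (p + p + n%:Z - 1 - r)
  else if k <= r + p + n%:Z - 1 then Some (k - r)
  else Some (w (k - (p + n%:Z - 1))).

Let rowfrom (r : int) (h m : nat) : seq (int * int) :=
  [seq (r, p + l%:Z) | l <- iota h m].

Let empty_wt (cs : seq (int * int)) : R :=
  \prod_(c <- cs | c.1 + c.2 < p + p + n%:Z - 1) (X c.1 * C c.2 - 1).

(** Before the antidiagonal both incoming edges are bare and the cell is empty; on it the pipe [w r]
    turns east; after it that pipe carries the smaller label and crosses all the others. *)
Lemma row_w0 G r h m : p <= r < p + n%:Z -> (h + m = n)%N ->
  (forall v, v (r + p + n%:Z - 1) <> Some (w r) -> G v = 0) ->
  evalc X C (rowfrom r h m) G (rword r h) =
  empty_wt (rowfrom r h m) * G (rword r n).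
Proof.
move=> rn hmn G0; elim: m h hmn => [|m IH] h hmn.
  by rewrite /empty_wt big_nil mul1r -hmn addn0.
have {}IH := IH h.+1; rewrite /rowfrom /= -/(rowfrom _ _ _).
rewrite /empty_wt big_cons /= -/(empty_wt _) /vert /locop.
have -> : cpos (r, p + h%:Z) = r + p + h%:Z - 1 by rewrite /cpos /=; lia.
have [hb|] := ltrP (r + (p + h%:Z)) (p + p + n%:Z - 1).
  have E : rword r h.+1 = rword r h.
    by apply/funext => k; rewrite /rword; word_cases.
  rewrite {1 2 4 5}/rword !ifT; try lia.
  by rewrite /= mul0r addr0 -E IH ?addSnnS //; ring.
rewrite le_eqVlt => /predU1P[hb|hb].
  have E : rword r h.+1 = rword r h.
    by apply/funext => k; rewrite /rword; word_cases.
  have -> : rword r h (r + p + h%:Z - 1) = None by rewrite /rword ifT //; lia.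
  have -> : rword r h (r + p + h%:Z - 1 + 1) = Some (p + h%:Z).
    by rewrite /rword; word_cases.
  (* The discarded term lets the pipe [w r] go straight north; its label is then out of reach of the
     rest of the row, where it has to exit. *)
  rewrite /= !mul1r [X in _ + X](@evalc_absent _ _ _ (r + p + h%:Z) (Some (w r))).
  - by rewrite addr0 -E IH // ?addSnnS.
  - by move=> c /mapP[l]; rewrite mem_iota => lm ->; rewrite /cpos /=; lia.
  - by move=> u ub; apply: G0; apply: ub; lia.
  move=> k kK; rewrite /= /simple; case: eqP => [|_]; first by lia.
  rewrite subrK; case: eqP => [_|ki]; first by rewrite /rword ifT //; lia.
  rewrite (w_rev rn) /rword; word_cases; case; try lia.
  case: (ltP (k - (p + n%:Z - 1)) (p + n%:Z)) => kn.
    by rewrite w_rev; lia.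
  by rewrite w_out; lia.
have -> : rword r h (r + p + h%:Z - 1) = Some (p + p + n%:Z - 1 - r).
  by rewrite /rword; word_cases.
have -> : rword r h (r + p + h%:Z - 1 + 1) = Some (p + h%:Z).
  by rewrite /rword; word_cases.
have -> : rword r h \o simple (r + p + h%:Z - 1) = rword r h.+1.
  apply/funext => k; rewrite /= /simple /rword.
  by repeat (case: eqP => ?); word_cases.
rewrite /= ifT; last by lia.
by rewrite ifT ?mul0r ?add0r ?mul1r ?IH ?addSnnS //; lia.
Qed.

Lemma pfun_w0 : pfun X C p n w =
  \prod_(c <- gridcells p n n | c.1 + c.2 < p + p + n%:Z - 1) (X c.1 * C c.2 - 1).
Proof.
rewrite -/(empty_wt _) /pfun.
have {1}-> : bword p n id = rword (p + n%:Z - 1) 0.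
  apply/funext => k; rewrite /bword /rword; word_cases.
  by rewrite w_out //; lia.
suff P m : (m <= n)%N -> evalc X C (gridcells p n m) (ind R (bword p n w))
    (rword (p + m%:Z - 1) 0) = empty_wt (gridcells p n m) by exact: P.
elim: m => [|m IH] mn.
  rewrite /empty_wt /= big_nil /ind asboolT //; apply/funext => k.
  by rewrite /bword /rword; word_cases.
rewrite /= evalc_cat.
have -> : p + m.+1%:Z - 1 = p + m%:Z by lia.
rewrite (@row_w0 _ _ 0 n) //; [|lia|].
  rewrite /empty_wt big_cat /= -/(empty_wt _) -/(empty_wt _); congr (_ * _).
  rewrite -IH 1?ltnW //; congr (evalc _ _ _ _); apply/funext => k; rewrite /rword.
  by word_cases; rewrite w_rev; [congr Some; lia | lia].
(* The rows above do not touch the east edge of row [p + m], so its label is already final. *)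
move=> v vr; apply: (@evalc_frozen _ _ _ (p + m%:Z + p + n%:Z - 1)).
  by move=> c /gridcellsP; rewrite /cpos; lia.
rewrite /bword ifT; last by lia.
by move=> E; apply: vr; rewrite E; congr (Some (w _)); lia.
Qed.

End LongestElement.

(** * Grothendieck polynomials as partition functions *)

Lemma swapx_monoid i : monoid_morphism (swapx i).
Proof.
by split; [apply: rename1; exact: swapx_varK | move=> f g; exact: swapxM].
Qed.

HB.instance Definition _ i :=
  GRing.isZmodMorphism.Build (fps var) (fps var) (swapx i) (swapxB i).
HB.instance Definition _ i :=
  GRing.isMonoidMorphism.Build (fps var) (fps var) (swapx i) (swapx_monoid i).

Lemma shift_zmod k : zmod_morphism (shift k).
Proof. by move=> f g; exact: renameB. Qed.

Lemma shift_monoid k : monoid_morphism (shift k).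
Proof.
have [sK Ks] := (@shift_varK k, @shift_varNK k).
by split; [exact: rename1 | move=> f g; exact: renameM].
Qed.

HB.instance Definition _ k :=
  GRing.isZmodMorphism.Build (fps var) (fps var) (shift k) (shift_zmod k).
HB.instance Definition _ k :=
  GRing.isMonoidMorphism.Build (fps var) (fps var) (shift k) (shift_monoid k).

Definition xs (i : int) : fps var := 1 - x i.
Definition ys (j : int) : fps var := (1 - a j)^-1.

Lemma ominusE i j : ominus (x i) (a j) = 1 - xs i * ys j.
Proof.
rewrite /ominus /xs /ys -[X in _ = X - _](divrr (unit_1suba j)) -mulrBl.
by congr (_ / _); ring.
Qed.

Lemma shiftB k f g : shift k (f - g) = shift k f - shift k g.
Proof. exact: renameB. Qed.

Lemma shiftM k f g : shift k (f * g) = shift k f * shift k g.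
Proof. exact: (shift_monoid k).2. Qed.

Lemma shift1 k : shift k 1 = 1.
Proof. exact: (shift_monoid k).1. Qed.

Lemma swapx1 i : swapx i 1 = 1.
Proof. exact: (swapx_monoid i).1. Qed.

Lemma shift_ominus k i j :
  shift k (ominus (x i) (a j)) = ominus (x (i + k)) (a (j + k)).
Proof.
rewrite /ominus shiftM; have := rmorphV (shift k) (unit_1suba j) => /= ->.
rewrite (shiftB k (x i)) (shiftB k 1) shift1.
(* [rewrite] would unfold [x i] and [a j] when comparing them. *)
generalize (shift_x k i) (shift_a k j).
by generalize (shift k (x i)) (shift k (a j)) => ? ? -> ->.
Qed.

Lemma swapx_xs i k : swapx i (xs k) = xs (simple i k).
Proof. by rewrite /xs (swapxB i 1) swapx1 (swapx_x i k). Qed.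

Lemma swapx_ys i k : swapx i (ys k) = ys k.
Proof.
rewrite /ys; have := rmorphV (swapx i) (unit_1suba k) => /= ->.
by rewrite (swapxB i 1) swapx1 (swapx_a i k).
Qed.

Lemma evalc_rmorph (R S : comNzRingType) (phi : {rmorphism R -> S})
    (X C : int -> R) cs (u v : lword) :
  phi (evalc X C cs (ind R u) v) =
  evalc (phi \o X) (phi \o C) cs (ind S u) v.
Proof.
elim: cs v => [|c cs IH] v /=.
  by rewrite /ind; case: ifP; rewrite ?rmorph1 ?rmorph0.
rewrite /vert /locop rmorphD !rmorphM !IH; congr (_ * _ + _ * _).
  rewrite /vertA; case: (v _) (v _) => [i|] [j|];
    rewrite ?rmorphN ?rmorphB ?rmorphM ?rmorph1 //.
  by case: ifP; rewrite ?rmorph1 ?rmorph0.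
rewrite /vertB; case: (v _) (v _) => [i|] [j|]; rewrite ?rmorph1 ?rmorph0 //.
by case: ifP; rewrite ?rmorph1 ?rmorph0.
Qed.

Lemma swapx_pfun i p n w :
  swapx i (pfun xs ys p n w) = pfun (xs \o simple i) ys p n w.
Proof.
rewrite /pfun; have := @evalc_rmorph _ _ (swapx i) => /= ->.
have -> : swapx i \o xs = xs \o simple i by apply/funext => k /=; rewrite swapx_xs.
by have -> : swapx i \o ys = ys by apply/funext => k /=; rewrite swapx_ys.
Qed.

Lemma shift_swapx k i f : shift k (swapx i f) = swapx (i + k) (shift k f).
Proof.
have [sK Ks] := (@shift_varK k, @shift_varNK k).
apply: fpsP => m /=; congr coef; apply: cmP_eq => v.
have K := @swapx_varK; rewrite !mcompE //; last exact: K; last exact: K.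
case: v => j //=; have -> // : simple i j + k = simple (i + k) (j + k).
by rewrite /simple; repeat case: eqP; lia.
Qed.

Lemma shift_subx k i j : shift k (x i - x j) = x (i + k) - x (j + k).
Proof.
rewrite shiftB; generalize (shift_x k i) (shift_x k j).
by generalize (shift k (x i)) (shift k (x j)) => ? ? -> ->.
Qed.

Lemma shift_1subx k i : shift k (1 - x i) = 1 - x (i + k).
Proof. by rewrite shiftB shift1 shift_x. Qed.

Lemma shift_tpi k i f : shift k (tpi i f) = tpi (i + k) (shift k f).
Proof.
have k1 : i + 1 + k = i + k + 1 by lia.
apply: tpi_uniq; rewrite -k1.
have L : shift k ((x i - x (i + 1)) * tpi i f) =
    (x (i + k) - x (i + 1 + k)) * shift k (tpi i f).
  by rewrite shiftM shift_subx.
apply: etrans (esym L) (etrans (congr1 (shift k) (tpiP i f)) _).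
exact: (etrans (shiftB k _ _) (f_equal2 (fun u v => u - v)
  (etrans (shiftM k _ _) (f_equal2 *%R (shift_1subx k (i + 1)) erefl))
  (etrans (shiftM k _ _) (f_equal2 *%R (shift_1subx k i) (shift_swapx k i f))))).
Qed.

Lemma big_gridcells (R : comNzRingType) p n m (P : pred (int * int))
    (F : int * int -> R) :
  \prod_(c <- gridcells p n m | P c) F c =
  \prod_(0 <= i < m) \prod_(0 <= j < n | P (p + i%:Z, p + j%:Z)) F (p + i%:Z, p + j%:Z).
Proof.
elim: m => [|m IH]; first by rewrite big_nil big_geq.
rewrite /= big_cat IH big_nat_recr //= mulrC; congr (_ * _).
by rewrite big_map /index_iota subn0.
Qed.

Lemma groth_top_shift n p : shift (p - 1) (groth_top n) =
  (-1) ^+ len (w0 n) * pfun xs ys p n (gamma (p - 1) (w0 n)).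
Proof.
rewrite pfun_w0 => [|i ip|i ip]; last 2 first.
- by rewrite /gamma /w0; case: ifP; lia.
- by rewrite /gamma /w0; case: ifP; lia.
have [w0B w0b] : bijective (w0 n) /\ in_box 1 n (w0 n).
  by split; [exists (w0 n); exact: w0K|exact: w0_in_box].
rewrite (len_ninv (in_box_SZ w0B w0b)) ninv_w0.
have -> : (-1) ^+ count (fun c => c.1 + c.2 < 1 + n%:Z) (gridcells 1 n n) =
    \prod_(c <- gridcells 1 n n | c.1 + c.2 < 1 + n%:Z) (-1) :> fps var.
  by rewrite big_const_seq iter_mulr_1.
rewrite !big_gridcells -big_split /= /groth_top rmorph_prod big_add1 /=.
apply: eq_bigr => i _; rewrite rmorph_prod big_add1 /=.
have E j : (i.+1 + j.+1 <= n)%N = (1 + i%:Z + (1 + j%:Z) < 1 + n%:Z) by lia.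
have E' j : (i.+1 + j.+1 <= n)%N = (p + i%:Z + (p + j%:Z) < p + p + n%:Z - 1) by lia.
rewrite (eq_bigl _ _ E) -[X in _ * X](eq_bigl _ _ E') (eq_bigl _ _ E) -big_split.
apply: eq_bigr => j _ /=; rewrite shift_ominus ominusE.
have -> : i.+1%:Z + (p - 1) = p + i%:Z by lia.
have -> : j.+1%:Z + (p - 1) = p + j%:Z by lia.
by ring.
Qed.

(** Turns [pfun_exchange] into the equation of [tpi], with [u] and [u'] two consecutive variables;
    the extra [-1] comes from [w s_i] being one longer than [w]. *)
Lemma exchange_sign (R : comNzRingType) (e u u' Z Zs Zs' : R) :
  (1 - u' - (1 - u)) * Z = (1 - u) * Zs' - (1 - u') * Zs ->
  (u - u') * (e * Z) = (1 - u') * (- 1 * e * Zs) - (1 - u) * (- 1 * e * Zs').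
Proof.
move=> h; transitivity (e * ((1 - u' - (1 - u)) * Z)); first by ring.
by rewrite h; ring.
Qed.

(** The induction follows an arbitrary derivation, so the result applies to whichever series and
    size the choice in [groth] selects. *)
Lemma groth_pfun n p u f : is_groth n u f ->
  shift (p - 1) f = (-1) ^+ len u * pfun xs ys p n (gamma (p - 1) u).
Proof.
elim=> [|v i g i0 iN + gg IH]; first exact: groth_top_shift.
have [sB sb] := is_groth_box gg.
have vS : SZ v.
  by rewrite -(comp_simpleK v i); apply: SZ_simple; exact: in_box_SZ sB sb.
rewrite len_lt // => vi; rewrite shift_tpi IH; apply/esym/tpi_uniq.
rewrite len_asc // exprS gammaM gamma_k_simple.
set k := p - 1; set w := gamma k v; set j := i + k.
have wj : w j < w (j + 1).
  by rewrite /w /gamma /j addrK (_ : i + k + 1 - k = i + 1); lia.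
have sgn m : swapx j ((-1) ^+ m) = (-1) ^+ m.
  by have := rmorph_sign (swapx j) m.
rewrite -exprS swapxM sgn swapx_pfun exprS; apply: exchange_sign.
by apply: pfun_exchange => //; rewrite /j /k; lia.
Qed.

(** * Partition functions as sums over tilings *)

Definition tiles := [:: Empty; NW; SE; Horizontal; Vertical; Crossing].

(** Only the incoming edges are tested; the outgoing ones are incoming for later cells or belong to
    the final word. *)
Definition tok (t : tile) (c d : label) : bool :=
  (west t == isSome c) && (south t == isSome d).

Definition tswap (t : tile) (c d : label) : bool :=
  match t with
  | Horizontal | Vertical => true
  | Crossing => ltl c d
  | _ => false
  end.

Definition twt (R : comNzRingType) (u : R) (t : tile) : R :=
  match t with Empty => - u | NW => 1 - u | _ => 1 end.

Definition step (D : tiling) (c : int * int) (v : lword) : lword :=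
  if tswap (D c.1 c.2) (v (cpos c)) (v (cpos c + 1)) then v \o simple (cpos c)
  else v.

Definition run (D : tiling) cs v := foldl (fun u c => step D c u) v cs.

Fixpoint valid (D : tiling) (cs : seq (int * int)) (v : lword) : bool :=
  if cs is c :: cs' then
    tok (D c.1 c.2) (v (cpos c)) (v (cpos c + 1)) && valid D cs' (step D c v)
  else true.

(** The pipe dream of the identity, which serves as background outside a box. *)
Definition hooks : tiling := fun i j =>
  if i == j then SE else if j < i then Vertical else Horizontal.

Definition upd (D : tiling) (c : int * int) (t : tile) : tiling :=
  fun i j => if (i, j) == c then t else D i j.

Definition refill (c : int * int) (Ds : seq tiling) : seq tiling :=
  [seq upd D c t | t <- tiles, D <- Ds].
Arguments refill : simpl never.

Definition tilings (cs : seq (int * int)) : seq tiling :=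
  foldr refill [:: hooks] cs.

Section Tilings.
Implicit Types (D : tiling) (c : int * int) (cs : seq (int * int)) (v : lword).

Lemma vert_tiles (R : comNzRingType) (u : R) k F v :
  vert u k F v =
  \sum_(t <- tiles | tok t (v k) (v (k + 1)))
    twt u t * F (if tswap t (v k) (v (k + 1)) then v \o simple k else v).
Proof.
rewrite /vert /locop; move: (v k) (v (k + 1)) => c d.
case: c d => [i|] [j|]; rewrite /tiles !big_cons big_nil /=; try by ring.
by case: ifP => _; ring.
Qed.

Lemma eq_step D D' c v : D c.1 c.2 = D' c.1 c.2 -> step D c v = step D' c v.
Proof. by rewrite /step => ->. Qed.

Lemma eq_valid D D' cs v : {in cs, forall c, D c.1 c.2 = D' c.1 c.2} ->
  valid D cs v = valid D' cs v.
Proof.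
elim: cs v => //= c cs IH v h.
have hc := h _ (mem_head _ _); rewrite (eq_step _ hc) hc IH // => d dcs.
by apply: h; rewrite inE dcs orbT.
Qed.

Lemma eq_run D D' cs v : {in cs, forall c, D c.1 c.2 = D' c.1 c.2} ->
  run D cs v = run D' cs v.
Proof.
rewrite /run; elim: cs v => //= c cs IH v h.
rewrite (eq_step _ (h _ (mem_head _ _))) IH // => d dcs.
by apply: h; rewrite inE dcs orbT.
Qed.

Lemma upd_at D c t : upd D c t c.1 c.2 = t.
Proof. by rewrite /upd -surjective_pairing eqxx. Qed.

Lemma upd_out D c t cs : c \notin cs ->
  {in cs, forall d, upd D c t d.1 d.2 = D d.1 d.2}.
Proof.
move=> cN d dcs; rewrite /upd -surjective_pairing ifN //.
by apply: contraNneq cN => <-.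
Qed.

Lemma evalc_tilings (R : comNzRingType) (X C : int -> R) cs F v : uniq cs ->
  evalc X C cs F v = \sum_(D <- tilings cs | valid D cs v)
    (\prod_(c <- cs) twt (1 - X c.1 * C c.2) (D c.1 c.2)) * F (run D cs v).
Proof.
elim: cs v => [|c cs IH] v /=; first by rewrite big_seq1 big_nil mul1r.
move=> /andP[cN ucs]; rewrite vert_tiles big_mkcond [RHS]big_mkcond.
rewrite big_allpairs_dep; apply: eq_bigr => t _.
case: ifP => tc; last first.
  by rewrite big1 // => D _; rewrite upd_at tc.
rewrite IH // big_distrr /= [LHS]big_mkcond; apply: eq_bigr => D _.
have E := upd_out D t cN; rewrite upd_at tc /= (eq_valid _ E).
have -> : step (upd D c t) c v =
    if tswap t (v (cpos c)) (v (cpos c + 1)) then v \o simple (cpos c) else v.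
  by rewrite /step upd_at.
case: ifP => // _; rewrite big_cons upd_at (eq_run _ E) mulrA.
congr (_ * _ * _); apply: eq_big_seq => d dcs; by rewrite E.
Qed.

Lemma mem_tiles t : t \in tiles.
Proof. by case: t; rewrite /tiles !inE eqxx ?orbT. Qed.

Lemma tilingsP cs D : reflect
  (forall i j, (i, j) \notin cs -> D i j = hooks i j) (D \in tilings cs).
Proof.
elim: cs D => [|c cs IH] D /=.
  rewrite inE; apply: (iffP eqP) => [-> //|h].
  by apply/funext => i; apply/funext => j; exact: h.
apply: (iffP allpairsP) => [[[t D'] /= [_ /IH D'cs ->]] i j|h].
  by rewrite inE negb_or /upd => /andP[/negPf -> /D'cs].
exists (D c.1 c.2, upd D c (hooks c.1 c.2)); split; first exact: mem_tiles.
  apply/IH => i j ijcs; rewrite /upd /=; case: ifPn => [/eqP <- //|ijc].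
  by apply: h; rewrite inE negb_or ijc.
apply/funext => i; apply/funext => j; rewrite /upd /=.
by case E : ((i, j) == c) => //; move/eqP: E => <-.
Qed.

Lemma tilings_uniq cs : uniq cs -> uniq (tilings cs).
Proof.
elim: cs => //= c cs IH /andP[cN /IH ucs]; apply: allpairs_uniq => //.
  (* Equality of tiles is classical and does not compute; the four edge bits tell the six tiles
     apart. *)
  by apply: (@map_uniq _ _ (fun t => (north t, south t, west t, east t))).
move=> P P' /allpairsP[[t D] [_ /tilingsP Dcs {P}->]].
move=> /allpairsP[[t' D'] /= [_ /tilingsP D'cs {P'}->]] /= E.
rewrite /= in Dcs D'cs.
have tt' : t = t' by move: (congr1 (fun T => T c.1 c.2) E); rewrite /= !upd_at.
congr pair => //; apply/funext => i; apply/funext => j.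
have [ijc|ijc] := eqVneq (i, j) c; first by rewrite (Dcs i j) ?(D'cs i j) /= ?ijc.
by move: (congr1 (fun T => T i j) E); rewrite /upd /= (negPf ijc).
Qed.

Lemma wt_tilings cs D : uniq cs -> D \in tilings cs ->
  wt D = \prod_(c <- cs) twt (ominus (x c.1) (a c.2)) (D c.1 c.2).
Proof.
move=> ucs /tilingsP Dcs.
have E t : t != SE -> t != Vertical -> t != Horizontal ->
    [set c : int * int | D c.1 c.2 = t] = [set` [seq c <- cs | D c.1 c.2 == t]].
  move=> t1 t2 t3; apply/seteqP; split => c /=; rewrite mem_filter; last by case/andP => /eqP.
  move=> Dc; rewrite Dc eqxx /=; apply: contraT; rewrite [c]surjective_pairing => /Dcs.
  rewrite Dc /hooks; do ?case: ifP => _; move=> /eqP.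
  - by rewrite (negPf t1).
  - by rewrite (negPf t2).
  - by rewrite (negPf t3).
have B (t : tile) (f : int * int -> fps var) :
    \big[*%R/1]_(c \in [set` [seq c <- cs | D c.1 c.2 == t]]) f c =
    \prod_(c <- cs) (if D c.1 c.2 == t then f c else 1).
  rewrite -[RHS]big_mkcond -[RHS]big_filter; apply/esym/fsbig_seq.
  exact: filter_uniq.
rewrite /wt !E; try by apply/eqP.
rewrite [X in X * _]B [X in _ * X]B -big_split; apply: eq_bigr => c _ /=.
by case: (D c.1 c.2); do 2![case: eqP => // _]; rewrite ?mulr1 ?mul1r.
Qed.

End Tilings.

(** * Words along the reading order *)

Section Ladders.
Implicit Types (P : int -> Prop) (i q : int).

Lemma up_from P q i : q <= i -> P q ->
  (forall k, q <= k < i -> P k -> P (k + 1)) -> P i.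
Proof.
move=> qi Pq Ps; have [m im] : exists m : nat, i = q + m%:Z.
  by exists (absz (i - q)%R); lia.
subst i; clear qi; elim: m Ps => [|m IH] Ps; first by rewrite addr0.
have -> : q + m.+1%:Z = q + m%:Z + 1 by lia.
by apply: (Ps); [lia | apply: IH => k km; apply: Ps; lia].
Qed.

Lemma down_from P q i : i <= q -> P q ->
  (forall k, i < k <= q -> P k -> P (k - 1)) -> P i.
Proof.
move=> iq Pq Ps; rewrite -[i]opprK.
apply: (@up_from (fun k => P (- k)) (- q)); rewrite ?opprK //; first by lia.
by move=> k kq; rewrite opprD; apply: Ps; lia.
Qed.

End Ladders.

Section Words.
Variables (D : tiling) (sl wl : int -> int -> label) (p q e : int).

(* The word met just before the cell [(i, j)], when the cells of the rows
   [q, q - 1, ...] and the columns [p, ..., e - 1] are read row by row. *)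
Definition cur (i j : int) : lword := fun k =>
  if k < i + p - 1 then None
  else if k < i + j - 1 then sl (i - 1) (k - i + 1)
  else if k == i + j - 1 then wl i j
  else if k < i + e then sl i (k - i)
  else if k < q + e then wl (k - e + 1) e
  else Some (k - q).

Definition local_rule (i j : int) := (sl (i - 1) j, wl i (j + 1)) =
  if tswap (D i j) (wl i j) (sl i j) then (sl i j, wl i j) else (wl i j, sl i j).

Definition start : lword := fun k => if p + q <= k then Some (k - q) else None.

Lemma cur_start : p <= e -> wl q p = None ->
  (forall j, p <= j < e -> sl q j = Some j) -> cur q p = start.
Proof.
move=> pe w0 s0; apply/funext => k; rewrite /cur /start.
do ![case: ifP => ?]; try lia; rewrite ?w0 ?s0 //; try lia; congr Some; lia.
Qed.

Lemma cur_row i : p <= e -> i <= q -> wl (i - 1) p = None -> cur i e = cur (i - 1) p.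
Proof.
move=> pe iq w0; apply/funext => k; rewrite /cur.
do ![case: ifP => ?]; try lia; rewrite ?w0 //; (congr sl || congr wl); lia.
Qed.

Lemma cur_west i j : p <= j -> cur i j (i + j - 1) = wl i j.
Proof. by move=> pj; rewrite /cur; do ![case: ifP => ? //]; lia. Qed.

Lemma cur_south i j : p <= j < e -> cur i j (i + j - 1 + 1) = sl i j.
Proof.
move=> pj; rewrite /cur; do ![case: ifP => ?]; try lia; congr sl; lia.
Qed.

Lemma cur_step i j : p <= j < e -> i <= q -> local_rule i j ->
  step D (i, j) (cur i j) = cur i (j + 1).
Proof.
move=> pj iq loc; rewrite /step /cpos /= cur_west; last by lia.
rewrite cur_south //; move: loc; rewrite /local_rule; case: ifP => _ [s1 w1].
  apply/funext => k /=; rewrite /simple; case: eqP => [->|k1].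
    rewrite cur_south // -s1 /cur; do ![case: ifP => ?]; try lia; congr sl; lia.
  case: eqP => [->|k2].
    rewrite cur_west; last by lia.
    rewrite -w1 /cur; do ![case: ifP => ?]; try lia; congr wl; lia.
  by rewrite /cur; do ![case: ifP => ?]; try lia.
apply/funext => k; have [->|k1] := eqVneq k (i + j - 1).
  rewrite cur_west; last by lia.
  by rewrite -s1 /cur; do ![case: ifP => ?]; try lia; congr sl; lia.
have [->|k2] := eqVneq k (i + j - 1 + 1).
  rewrite cur_south // -w1 /cur; do ![case: ifP => ?]; try lia; congr wl; lia.
by rewrite /cur; do ![case: ifP => ? //]; lia.
Qed.

Lemma reading_ind (P : int -> int -> Prop) i0 j0 :
  p <= j0 <= e -> i0 <= q -> P q p ->
  (forall i j, i0 <= i <= q -> p <= j < e -> i0 < i \/ j < j0 ->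
     P i j -> P i (j + 1)) ->
  (forall i, i0 < i <= q -> P i e -> P (i - 1) p) ->
  P i0 j0.
Proof.
move=> pj iq P0 Pc Pr; have row : P i0 p.
  apply: (@down_from (fun i => P i p) q) => // k kq Pk; apply: Pr => //.
  by apply: (@up_from (P k) p) => //; [lia | move=> l lp; apply: Pc; lia].
by apply: (@up_from (P i0) p) => //; [lia | move=> l lp; apply: Pc; lia].
Qed.

End Words.

Lemma start_inj p q k1 k2 c :
  start p q k1 = Some c -> start p q k2 = Some c -> k1 = k2.
Proof. by rewrite /start; do 2![case: ifP => // _]; move=> [<-] []; lia. Qed.

Lemma start_sorted p q k1 k2 b c : k1 < k2 ->
  start p q k1 = Some b -> start p q k2 = Some c -> b < c.
Proof. by move=> k12; rewrite /start; do 2![case: ifP => // _]; move=> [<-] [<-]; lia. Qed.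

Lemma step_inj D c (v : lword) :
  (forall k1 k2 b, v k1 = Some b -> v k2 = Some b -> k1 = k2) ->
  forall k1 k2 b, step D c v k1 = Some b -> step D c v k2 = Some b -> k1 = k2.
Proof.
rewrite /step => vI k1 k2 b; case: ifP => _; last exact: vI.
by move=> /= h1 h2; apply: (can_inj (@simpleK (cpos c))); exact: vI h1 h2.
Qed.

(** For [b < c], an inversion of the word; the starting word has none. *)
Definition overtaken (b c : int) (v : lword) :=
  exists k1 k2, [/\ k1 < k2, v k1 = Some c & v k2 = Some b].

(** An inversion is never undone: two labels trade places only at a crossing whose west label is the
    smaller one. *)
Lemma overtaken_step D d (v : lword) b c : b < c ->
  tok (D d.1 d.2) (v (cpos d)) (v (cpos d + 1)) ->
  overtaken b c (step D d v) <->
  overtaken b c v \/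
    [/\ D d.1 d.2 = Crossing, v (cpos d) = Some b & v (cpos d + 1) = Some c].
Proof.
move=> bc ok; rewrite /step; set k := cpos d in ok *; set t := D _ _ in ok *.
case: ifP => sw; last first.
  split=> [|[//|[tC vk vk1]]]; first by left.
  by rewrite tC vk vk1 /= bc in sw.
have lts k1 k2 : k1 < k2 -> (k1, k2) != (k, k + 1) -> simple k k1 < simple k k2.
  by rewrite xpair_eqE /simple; repeat case: eqP => //=; lia.
split=> [[k1 [k2 [k12 /= v1 v2]]]|].
  have [[E1 E2]|ne] := eqVneq (k1, k2) (k, k + 1).
    rewrite E1 E2 simple_l simple_r in v1 v2; right; split => //.
    by move: ok; rewrite /tok v1 v2; case: (t).
  by left; exists (simple k k1), (simple k k2); split => //; exact: lts.
move=> [[k1 [k2 [k12 v1 v2]]]|[tC v1 v2]]; last first.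
  by exists k, (k + 1); split; rewrite /= ?simple_l ?simple_r //; lia.
have [[E1 E2]|ne] := eqVneq (k1, k2) (k, k + 1).
  exfalso; rewrite E1 in v1; rewrite E2 in v2; move: ok sw; rewrite /tok v1 v2.
  by case: (t) => //= _; lia.
exists (simple k k1), (simple k k2); rewrite /= !simpleK; split => //.
exact: lts.
Qed.

(* At a crossing of [(i0, j0)], the local rule (the larger label leaves north)
   agrees with the rule on pipes that have already crossed. *)
Lemma crossed_iff D sl wl p q i0 j0 b c :
  p <= j0 -> i0 <= q ->
  (forall i, i0 <= i <= q -> wl i p = None) ->
  (forall j, p <= j <= j0 -> sl q j = Some j) ->
  (forall i j, i0 <= i <= q -> p <= j <= j0 -> i0 < i \/ j < j0 ->
     tok (D i j) (wl i j) (sl i j) /\ local_rule D sl wl i j) ->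
  wl i0 j0 = Some b -> sl i0 j0 = Some c ->
  b <> c /\
  (c < b <-> exists i j, [/\ i0 <= i <= q, p <= j <= j0, i0 < i \/ j < j0 &
      D i j = Crossing /\ (wl i j = Some c /\ sl i j = Some b \/
                          wl i j = Some b /\ sl i j = Some c) /\
      ltl (wl i j) (sl i j)]).
Proof.
(* Pipes travel north and east, so those meeting at [(i0, j0)] have only visited columns up to [j0];
   the word is cut off there. *)
move=> pj iq w0 s0 cells wb sc; set e := j0 + 1.
pose u := cur sl wl p q e.
have st : u q p = start p q.
  by apply: cur_start; rewrite ?w0 //; try lia; move=> j je; apply: s0; lia.
have nx i j : i0 <= i <= q -> p <= j < e -> i0 < i \/ j < j0 ->
    tok (D i j) (u i j (cpos (i, j))) (u i j (cpos (i, j) + 1)) /\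
    u i (j + 1) = step D (i, j) (u i j).
  move=> iq' je ij; have [|ok loc] := cells i j iq' _ ij; first by lia.
  rewrite /u /cpos /= cur_west ?cur_south //; try lia; split => //.
  by rewrite (@cur_step D) //; lia.
have rw i : i0 < i <= q -> u i e = u (i - 1) p.
  by move=> iq'; apply: cur_row; rewrite ?w0 //; lia.
have inj : forall k1 k2 d, u i0 j0 k1 = Some d -> u i0 j0 k2 = Some d -> k1 = k2.
  apply: (@reading_ind p q e (fun i j => forall k1 k2 d,
    u i j k1 = Some d -> u i j k2 = Some d -> k1 = k2)); try lia.
  - by rewrite st; exact: start_inj.
  - move=> i j iq' je ij IH; have [_ ->] := nx i j iq' je ij; exact: step_inj.
  - by move=> i iq'; rewrite rw.
have track d d' : d < d' -> overtaken d d' (u i0 j0) <->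
    exists i j, [/\ i0 <= i <= q, p <= j <= j0, i0 < i \/ (i = i0 /\ j < j0) &
      [/\ D i j = Crossing, wl i j = Some d & sl i j = Some d']].
  move=> dd'; apply: (@reading_ind p q e (fun a' b' => overtaken d d' (u a' b') <->
    exists i j, [/\ a' <= i <= q, p <= j <= j0, a' < i \/ (i = a' /\ j < b') &
      [/\ D i j = Crossing, wl i j = Some d & sl i j = Some d']])); try lia.
  - rewrite st; split => [[k1 [k2 [k12 /(start_sorted k12) h /h]]]|]; first by lia.
    by move=> [i [j [? ? ?]]]; lia.
  - move=> i j iq' je ij IH; have [ok ->] := nx i j iq' je ij.
    rewrite (overtaken_step dd' ok) IH /u /cpos /= cur_west ?cur_south //; try lia.
    split=> [[[i' [j' [h1 h2 h3 h4]]]|h]|[i' [j' [h1 h2 h3 h4]]]].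
    + by exists i', j'; split => //; lia.
    + by exists i, j; split => //; lia.
    + have [E|ne] := eqVneq (i', j') (i, j); first by right; case: E h4 => -> ->.
      left; exists i', j'; split => //; move: ne; rewrite xpair_eqE; lia.
  - move=> i iq'; rewrite rw // => ->; split=> -[i' [j' [h1 h2 h3 h4]]];
      by exists i', j'; split => //; lia.
have ub : u i0 j0 (i0 + j0 - 1) = Some b by rewrite /u cur_west.
have uc : u i0 j0 (i0 + j0 - 1 + 1) = Some c by rewrite /u cur_south //; lia.
have bc : b <> c by move=> E; rewrite E in ub; have := inj _ _ _ ub uc; lia.
split=> //; split=> [cb|[i [j [h1 h2 h3 [DC [[[wij sij]|[wij sij]] lt]]]]]].
- have [i [j [h1 h2 h3 [DC wij sij]]]] := (track _ _ cb).1 (ex_intro _ _ (ex_intro _ _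
    (And3 (ltac:(lia) : i0 + j0 - 1 < i0 + j0 - 1 + 1) ub uc))).
  exists i, j; split => //; first by lia.
  by rewrite wij sij /=; split => //; split => //; left.
- by move: lt; rewrite wij sij.
(* Such a crossing would have put [c] to the left of [b], whereas the word now has [b] just left of
   [c]. *)
- have {}lt : b < c by move: lt; rewrite wij sij.
  have [|k1 [k2 [k12 u1 u2]]] := (track _ _ lt).2.
    by exists i, j; split => //; lia.
  by have := inj _ _ _ u1 uc; have := inj _ _ _ u2 ub; lia.
Qed.

(** * The shape of pipe dreams *)

Definition boxed (p q : int) (D : tiling) :=
  forall i j, ~~ ((p <= i <= q) && (p <= j <= q)) -> D i j = hooks i j.

Section Structure.
Implicit Types (D : tiling) (p q i j : int).

Lemma hooks_diag i : hooks i i = SE.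
Proof. by rewrite /hooks eqxx. Qed.

Lemma hooks_below i j : j < i -> hooks i j = Vertical.
Proof. by move=> ji; rewrite /hooks ji; case: eqP => //; lia. Qed.

Lemma hooks_above i j : i < j -> hooks i j = Horizontal.
Proof. by move=> ji; rewrite /hooks ifF; [rewrite ifF //|]; lia. Qed.

Lemma matching_south D i j : matching D -> south (D (i - 1) j) = north (D i j).
Proof. by move=> /(_ (i - 1) j)[-> _]; rewrite subrK. Qed.

Lemma matching_east D i j : matching D -> east (D i (j - 1)) = west (D i j).
Proof. by move=> /(_ i (j - 1))[_ ->]; rewrite subrK. Qed.

(** A large hook leaves open whether its straight tiles are crossings. They are not: the absence of
    a transverse pipe propagates from the elbows on the diagonal, or from the far west and the far
    north. *)
Lemma kbpd_boxed D : kbpd D -> exists M : int, 0 <= M /\ boxed (- M) M D.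
Proof.
move=> [mD [M0 hM] [sS sE sW sN]]; set M := `|M0|.
have hk N : M <= `|N| -> hook D N by move=> h; apply: hM; rewrite /M in h; lia.
have VX (t : tile) : t = Vertical \/ t = Crossing -> west t = false -> t = Vertical.
  by case=> ->.
have VX' (t : tile) : t = Vertical \/ t = Crossing -> east t = false -> t = Vertical.
  by case=> ->.
have HX (t : tile) : t = Horizontal \/ t = Crossing -> north t = false -> t = Horizontal.
  by case=> ->.
have HX' (t : tile) : t = Horizontal \/ t = Crossing -> south t = false -> t = Horizontal.
  by case=> ->.
have M0' : 0 <= M by rewrite /M; lia.
have diag N : M <= `|N| -> D N N = SE by move=> /hk[].
have A i j : M <= j -> j < i -> D i j = Vertical.
  move=> Mj ji; have V k : M <= k < i -> east (D i k) = false -> D i k = Vertical.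
    by move=> kM; apply: VX'; have [|_ h _] := hk k; [lia | apply: h; lia].
  apply: (V); first by lia.
  apply: (@down_from (fun k => east (D i k) = false) (i - 1)); first by lia.
    by rewrite (mD i (i - 1)).2 subrK diag //; lia.
  move=> k kM ek; rewrite (mD i (k - 1)).2 subrK (V k) //; lia.
(* These columns need not carry a large hook. Going left from column [M], no pipe leaves a column
   eastwards, and the pipe known far south in that column must then be vertical. *)
have B j : j < M -> forall i, M <= i -> D i j = Vertical.
  move=> jM; have col k : (forall i, M <= i -> east (D i k) = false) ->
               (forall i, M <= i -> D i k = Vertical).
    move=> ek i Mi; have [R sR] := sS k.
    have sk : south (D i k).
      have [Ri|iR] := lerP R i; first exact: sR.
      apply: (@down_from (fun l => south (D l k)) R); rewrite ?sR //; first by lia.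
      move=> l lR sl; rewrite matching_south //; have := ek l; move: sl.
      by case: (D l k) => //= _ h; have := h (ltac:(lia) : M <= l).
    by have := ek i Mi; move: sk; case: (D i k).
  apply: (col).
  apply: (@down_from (fun k => forall i, M <= i -> east (D i k) = false) (M - 1)).
  - by lia.
  - move=> i Mi; rewrite matching_east //.
    have [->|iM] := eqVneq i M; first by rewrite diag //; lia.
    by rewrite A //; lia.
  - by move=> k kM /col h i Mi; rewrite matching_east // h.
have A' i j : M <= i -> i < j -> D i j = Horizontal.
  move=> Mi ij; have V k : M <= k < j -> south (D k j) = false -> D k j = Horizontal.
    by move=> kM; apply: HX'; have [|_ _ h] := hk k; [lia | apply: h; lia].
  apply: (V); first by lia.
  apply: (@down_from (fun k => south (D k j) = false) (j - 1)); first by lia.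
    by rewrite matching_south // diag //; lia.
  by move=> k kM ek; rewrite matching_south // (V k) //; lia.
have B' i : i < M -> forall j, M <= j -> D i j = Horizontal.
  move=> iM.
  have row k : (forall j, M <= j -> south (D k j) = false) ->
               (forall j, M <= j -> D k j = Horizontal).
    move=> ek j Mj; have [R sR] := sE k.
    have sk : east (D k j).
      have [Rj|jR] := lerP R j; first exact: sR.
      apply: (@down_from (fun l => east (D k l)) R); rewrite ?sR //; first by lia.
      move=> l lR el; rewrite matching_east //; have := ek l; move: el.
      by case: (D k l) => //= _ h; have := h (ltac:(lia) : M <= l).
    by have := ek j Mj; move: sk; case: (D k j).
  apply: (row).
  apply: (@down_from (fun k => forall j, M <= j -> south (D k j) = false) (M - 1)).
  - by lia.
  - move=> j Mj; rewrite matching_south //.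
    have [->|jM] := eqVneq j M; first by rewrite diag //; lia.
    by rewrite A' //; lia.
  - by move=> k kM /row h j Mj; rewrite matching_south // h.
have C i j : j <= - M -> j < i -> D i j = Vertical.
  move=> jM ji; have V k : k <= j -> west (D i k) = false -> D i k = Vertical.
    by move=> kj; apply: VX; have [|_ h _] := hk k; [lia | apply: h; lia].
  apply: (V) => //; have [c wc] := sW i.
  have [jc|cj] := lerP j c; first exact/negbTE/wc.
  apply: (@up_from (fun k => west (D i k) = false) c); first by lia.
    exact/negbTE/wc.
  by move=> k kc wk; rewrite -(mD i k).2 (V k) //; lia.
have C' i j : i <= - M -> i < j -> D i j = Horizontal.
  move=> iM ij; have V k : k <= i -> north (D k j) = false -> D k j = Horizontal.
    by move=> ki; apply: HX; have [|_ _ h] := hk k; [lia | apply: h; lia].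
  apply: (V) => //; have [c nc] := sN j.
  have [ic|ci] := lerP i c; first exact/negbTE/nc.
  apply: (@up_from (fun k => north (D k j) = false) c); first by lia.
    exact/negbTE/nc.
  by move=> k kc wk; rewrite -(mD k j).1 (V k) //; lia.
exists M; split => // i j out; have [ij|ij] := eqVneq i j.
  rewrite -ij in out *; have [iM|iM] := lerP M `|i|; last by lia.
  by rewrite diag // hooks_diag.
have {}out : M <= `|i| \/ M <= `|j| by move: out; lia.
have [ji|ij'] := ltrP j i; [rewrite hooks_below //|rewrite hooks_above; last by lia].
  have [iM|iM] := lerP M i; first by have [Mj|jM] := lerP M j; [exact: A | exact: B].
  by apply: C => //; lia.
have [jM|jM] := lerP M j; last by apply: C'; lia.
by have [Mi|iM] := lerP M i; [apply: A'; lia | exact: B'].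
Qed.

Lemma boxed_kbpd p q D : boxed p q D -> matching D -> kbpd D.
Proof.
move=> bD mD; split => //.
  exists (`|p| + `|q| + 1) => N hN.
  have out i j : ~~ (p <= i <= q) || ~~ (p <= j <= q) -> D i j = hooks i j.
    by move=> h; apply: bD; rewrite negb_and.
  split => [|i Ni|j Nj]; rewrite out.
  - exact: hooks_diag.
  - by lia.
  - by left; exact: hooks_below.
  - by lia.
  - by left; exact: hooks_above.
  - by lia.
have out i j : ~~ (p <= i <= q) || ~~ (p <= j <= q) -> D i j = hooks i j.
  by move=> h; apply: bD; rewrite negb_and.
split => k.
- exists (Num.max k (q + 1)) => i ik; rewrite out; last by lia.
  have [->|h] := eqVneq i k; first by rewrite hooks_diag.
  by rewrite hooks_below //; lia.
- exists (Num.max k (q + 1)) => i ik; rewrite out; last by lia.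
  have [->|h] := eqVneq k i; first by rewrite hooks_diag.
  by rewrite hooks_above //; lia.
- exists (Num.min k (p - 1)) => i ik; rewrite out; last by lia.
  have [->|h] := eqVneq k i; first by rewrite hooks_diag.
  by rewrite hooks_below //; lia.
- exists (Num.min k (p - 1)) => i ik; rewrite out; last by lia.
  have [->|h] := eqVneq i k; first by rewrite hooks_diag.
  by rewrite hooks_above //; lia.
Qed.

Lemma boxed_widen p q p' q' D : p' <= p -> q <= q' -> boxed p q D -> boxed p' q' D.
Proof. by move=> pp qq bD i j out; apply: bD; move: out; lia. Qed.

(** No pipe meets the north or west side of the box, so a nonempty corner is an SE elbow, whose pipe
    then runs straight along both row and column [p]. *)
Lemma boxed_trim_NW p q D : matching D -> boxed p q D -> p <= q ->
  D p p <> Empty -> boxed (p + 1) q D.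
Proof.
move=> mD bD pq Dp.
have n0 j : p <= j -> north (D p j) = false.
  by move=> pj; rewrite -matching_south // bD ?hooks_above //; lia.
have w0 i : p <= i -> west (D i p) = false.
  by move=> pi; rewrite -matching_east // bD ?hooks_below //; lia.
have Dpp : D p p = SE.
  by move: Dp (n0 p (lexx p)) (w0 p (lexx p)); case: (D p p).
have row j : p < j -> D p j = Horizontal.
  move=> pj; have H k : p < k -> west (D p k) -> D p k = Horizontal.
    by move=> pk; have := n0 k (ltW pk); case: (D p k).
  apply: (H) => //; apply: (@up_from (fun k => west (D p k)) (p + 1)); first by lia.
    by rewrite -(mD p p).2 Dpp.
  by move=> k kp wk; rewrite -(mD p k).2 H //; lia.
have col i : p < i -> D i p = Vertical.
  move=> pi; have H k : p < k -> north (D k p) -> D k p = Vertical.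
    by move=> pk; have := w0 k (ltW pk); case: (D k p).
  apply: (H) => //; apply: (@up_from (fun k => north (D k p)) (p + 1)); first by lia.
    by rewrite -(mD p p).1 Dpp.
  by move=> k kp wk; rewrite -(mD k p).1 H //; lia.
move=> i j out; have [ip|ip] := eqVneq i p.
  rewrite ip; have [jp|pj|->] := ltgtP j p; last by rewrite Dpp hooks_diag.
    by apply: bD; lia.
  by rewrite row // hooks_above.
have [jp|jp] := eqVneq j p; last by apply: bD; lia.
rewrite jp; have [ip'|pi|] := ltgtP i p; last by lia.
  by apply: bD; lia.
by rewrite col // hooks_below.
Qed.

(** Every south edge of row [q] carries a pipe; west of the elbow nothing may leave eastwards, so
    these pipes go straight up. Column [q] is symmetric. *)
Lemma boxed_trim_SE p q D : matching D -> boxed p q D -> p <= q ->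
  D q q = SE -> boxed p (q - 1) D.
Proof.
move=> mD bD pq Dqq.
have s1 j : j <= q -> south (D q j).
  by move=> jq; rewrite (mD q j).1 bD ?hooks_below //; lia.
have e1 i : i <= q -> east (D i q).
  by move=> iq; rewrite (mD i q).2 bD ?hooks_above //; lia.
have row j : j < q -> D q j = Vertical.
  move=> jq; have V k : k < q -> east (D q k) = false -> D q k = Vertical.
    by move=> kq; have := s1 k (ltW kq); case: (D q k).
  apply: (V) => //.
  apply: (@down_from (fun k => east (D q k) = false) (q - 1)); first by lia.
    by rewrite matching_east // Dqq.
  by move=> k kq ek; rewrite matching_east // V //; lia.
have col i : i < q -> D i q = Horizontal.
  move=> iq; have V k : k < q -> south (D k q) = false -> D k q = Horizontal.
    by move=> kq; have := e1 k (ltW kq); case: (D k q).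
  apply: (V) => //.
  apply: (@down_from (fun k => south (D k q) = false) (q - 1)); first by lia.
    by rewrite matching_south // Dqq.
  by move=> k kq ek; rewrite matching_south // V //; lia.
move=> i j out; have [iq|iq] := eqVneq i q.
  rewrite iq; have [jq|qj|->] := ltgtP j q; last by rewrite Dqq hooks_diag.
    by rewrite row // hooks_below.
  by apply: bD; lia.
have [jq|jq] := eqVneq j q; last by apply: bD; lia.
rewrite jq; have [iq'|qi|] := ltgtP i q; last by lia.
  by rewrite col // hooks_above.
by apply: bD; lia.
Qed.

End Structure.

(** * Labellings and the local rule *)

(** Presence of a pipe is decided by the neighbouring cell to the south, or to the west for [wlab];
    [tok] at a cell is then the matching condition on its south and west edges. *)
Definition slab (D : tiling) (S : int -> int -> int) (i j : int) : label :=
  if north (D (i + 1) j) then Some (S i j) else None.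
Definition wlab (D : tiling) (W : int -> int -> int) (i j : int) : label :=
  if east (D i (j - 1)) then Some (W i j) else None.

(** On edges without pipe the value is immaterial; passing [s] on keeps [S i j = j] in the columns
    outside the box. *)
Definition nout (t : tile) (w s : int) : int :=
  match t with NW => w | Crossing => Num.max w s | _ => s end.
Definition eout (t : tile) (w s : int) : int :=
  match t with SE => s | Crossing => Num.min w s | _ => w end.

Section Labelling.
Implicit Types (D : tiling) (S W : int -> int -> int) (p q i j : int).

Lemma slab_pred D S i j :
  slab D S (i - 1) j = if north (D i j) then Some (S (i - 1) j) else None.
Proof. by rewrite /slab subrK. Qed.

Lemma wlab_succ D W i j :
  wlab D W i (j + 1) = if east (D i j) then Some (W i (j + 1)) else None.
Proof. by rewrite /wlab addrK. Qed.

Lemma matching_slab D S i j : matching D ->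
  slab D S i j = if south (D i j) then Some (S i j) else None.
Proof. by move=> mD; rewrite /slab -(mD i j).1. Qed.

Lemma matching_wlab D W i j : matching D ->
  wlab D W i j = if west (D i j) then Some (W i j) else None.
Proof. by move=> mD; rewrite /wlab matching_east. Qed.

Lemma matching_tok D S W i j : matching D ->
  tok (D i j) (wlab D W i j) (slab D S i j).
Proof.
move=> mD; rewrite matching_slab // matching_wlab // /tok.
by case: (west _); case: (south _).
Qed.

Lemma out_local D S W i j : tok (D i j) (wlab D W i j) (slab D S i j) ->
  S (i - 1) j = nout (D i j) (W i j) (S i j) ->
  W i (j + 1) = eout (D i j) (W i j) (S i j) ->
  local_rule D (slab D S) (wlab D W) i j.
Proof.
move=> /andP[wt st] SE WE; rewrite /local_rule slab_pred wlab_succ SE WE.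
move: wt st; rewrite /wlab /slab.
case: (D i j); case: ifP => _ //; case: ifP => _ //= _ _.
by case: ltgtP => [|| ->].
Qed.

Lemma boxed_wlab p q D W i : boxed p q D -> p <= i -> wlab D W i p = None.
Proof. by move=> bD pi; rewrite /wlab bD ?hooks_below //; lia. Qed.

Lemma boxed_slab p q D S j : boxed p q D -> j <= q -> slab D S q j = Some (S q j).
Proof. by move=> bD jq; rewrite /slab bD ?hooks_below //; lia. Qed.

Lemma boxed_crossing p q D i j : boxed p q D -> D i j = Crossing ->
  p <= i <= q /\ p <= j <= q.
Proof.
move=> bD DC; apply/andP; apply: contraPT DC => /bD ->.
by rewrite /hooks; case: ifP => // _; case: ifP.
Qed.

(** Under the local rule, a crossing is traversed straight exactly when its west label is the
    smaller one. The rule is assumed only at other cells weakly south-west, which permits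
    induction. *)
Lemma already_iff D S W p q i j : matching D -> boxed p q D ->
  (forall j, p <= j <= q -> S q j = j) ->
  (forall i' j', i <= i' <= q -> p <= j' <= j -> i < i' \/ j' < j ->
     local_rule D (slab D S) (wlab D W) i' j') ->
  D i j = Crossing ->
  W i j <> S i j /\ (S i j < W i j <-> already_crossed D S W (W i j) (S i j) i j).
Proof.
move=> mD bD S0 loc DC; have [iq jq] := boxed_crossing bD DC.
have tiC k l (C : D k l = Crossing) :
    wlab D W k l = Some (W k l) /\ slab D S k l = Some (S k l).
  by rewrite matching_wlab // matching_slab // C.
have [wij sij] := tiC _ _ DC.
have [|||||ne iff] := @crossed_iff D _ _ p q i j _ _ _ _ _ _ _ wij sij; try lia.
- by move=> k kq; apply: boxed_wlab bD _; lia.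
- by move=> k kj; rewrite (boxed_slab _ bD) ?S0 //; lia.
- by move=> k l kq lj kl; split; [exact: matching_tok | exact: loc].
split=> //; split=> [/iff.1 [k [l [kq lj kl [C [lab lt]]]]]|[k [l [ik lj ne' [C lab [SE WE]]]]]].
  exists k, l; split; [lia|lia|by move=> [? ?]; lia|].
  have [wkl skl] := tiC _ _ C; have := loc k l kq lj kl.
  rewrite /local_rule slab_pred wlab_succ C /= lt wkl skl => -[SE WE].
  split => //; move: lab; rewrite wkl skl.
  by move=> [[[->] [->]]|[[->] [->]]]; [right|left].
have [kq lq] := boxed_crossing bD C; have [wkl skl] := tiC _ _ C.
have kl : i < k \/ l < j.
  have [/eqP ki|] := eqVneq k i; have [/eqP lj'|] := eqVneq l j; try lia.
  by case: ne'; rewrite (eqP ki) (eqP lj').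
apply/iff; exists k, l; split => //; [lia|lia|].
rewrite wkl skl /=; split => //; split.
  by move: lab => [[-> ->]|[-> ->]]; [right|left].
have := loc k l (ltac:(lia)) (ltac:(lia)) kl.
(* Otherwise the pipes bounce by the local rule and also go straight by [cross_at], which makes
   their labels equal. *)
rewrite /local_rule slab_pred wlab_succ C wkl skl /=; case: ltP => // le [SE' _].
by exfalso; apply: ne; move: lab; rewrite -SE SE' => -[[-> <-]|[<- ->]].
Qed.

Lemma labelling_south p q D S W : boxed p q D -> is_labelling D S W ->
  forall j, p <= j <= q -> S q j = j.
Proof.
move=> bD [S0 fo] j jq; have [R SR] := S0 j.
have [Rq|qR] := lerP R q; first exact: SR.
apply: (@down_from (fun i => S i j = j) R); [lia|exact: SR|].
by move=> k kR Sk; have := fo k j; rewrite /follow bD ?hooks_below //; [move=> -> | lia | lia].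
Qed.

(** Induction on the distance to the south-west corner, since [follow] consults only crossings
    weakly south-west of the cell. *)
Lemma labelling_local p q D S W : matching D -> boxed p q D -> is_labelling D S W ->
  forall i j, p <= i <= q -> p <= j <= q -> local_rule D (slab D S) (wlab D W) i j.
Proof.
move=> mD bD lab; have S0 := labelling_south bD lab.
suff P (m : nat) i j : p <= i <= q -> p <= j <= q -> (q - i) + (j - p) < m%:Z ->
    local_rule D (slab D S) (wlab D W) i j.
  by move=> i j iq jq; apply: (P (absz (q - i + (j - p))%R).+1); lia.
elim: m i j => [|m IH] i j iq jq ijm; first by lia.
have al := @already_iff D S W p q i j mD bD S0.
have {}al := al (fun k l kq lj kl => IH k l (ltac:(lia)) (ltac:(lia)) (ltac:(lia))).
have := lab.2 i j; rewrite /follow /local_rule slab_pred wlab_succ.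
rewrite matching_slab // matching_wlab //.
case DE : (D i j) => //= ; do 1?[by move=> ->].
have [ne iff] := al DE; move=> [ac nac].
case: ltP => [lt|le].
  by have [|-> ->] := nac; [move=> /iff; lia|].
by have [|-> ->] := ac; [apply/iff; lia|].
Qed.

End Labelling.

Section Existence.
Variables (p q : int) (D : tiling).

(** The initial [0] is arbitrary: no pipe enters the box from the west. *)
Fixpoint wrow (i : int) (s : int -> int) (h : nat) : int :=
  if h is h'.+1 then eout (D i (p + h'%:Z)) (wrow i s h') (s (p + h'%:Z)) else 0.

Fixpoint scol (h : nat) : int -> int :=
  if h is h'.+1 then fun j =>
    nout (D (q - h'%:Z) j) (wrow (q - h'%:Z) (scol h') (absz (j - p)%R)) (scol h' j)
  else id.

Lemma labels_exist : boxed p q D -> exists S W,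
  [/\ forall i j, q <= i -> S i j = j,
      forall i j, ~~ (p <= j <= q) -> S i j = j,
      forall i j, ~~ (p <= i <= q) -> W i j = i &
      forall i j, p <= i <= q -> p <= j ->
        S (i - 1) j = nout (D i j) (W i j) (S i j) /\
        W i (j + 1) = eout (D i j) (W i j) (S i j)].
Proof.
move=> bD; pose S i j := if q <= i then j else scol (absz (q - i)%R) j.
pose W i j := if p <= i <= q then wrow i (S i) (absz (j - p)%R) else i.
have SE i : i <= q -> S i = scol (absz (q - i)%R).
  rewrite /S => iq; apply/funext => j; case: ifP => // qi.
  by rewrite (_ : absz (q - i)%R = 0%N) //; lia.
have Sp i j : i <= q -> S (i - 1) j = nout (D i j) (wrow i (S i) (absz (j - p)%R)) (S i j).
  move=> iq; rewrite SE; last by lia.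
  rewrite (_ : absz (q - (i - 1))%R = (absz (q - i)%R).+1) /=; last by lia.
  by rewrite (_ : q - (absz (q - i)%R)%:Z = i) ?SE //; lia.
exists S, W; split => [i j qi|i j jq|i j iq|i j iq pj].
- by rewrite /S qi.
- have [qi|iq] := lerP q i; first by rewrite /S qi.
  apply: (@down_from (fun k => S k j = j) q); [lia|by rewrite /S lexx|].
  move=> k kq Sk; rewrite Sp ?Sk; last by lia.
  by rewrite bD; [rewrite /hooks; do 2?case: ifP | lia].
- by rewrite /W ifN.
- rewrite /W iq; split; first by rewrite Sp //; lia.
  rewrite (_ : absz (j + 1 - p)%R = (absz (j - p)%R).+1) /=; last by lia.
  by rewrite (_ : p + (absz (j - p)%R)%:Z = j) //; lia.
Qed.

End Existence.

Section Labels.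
Implicit Types (D : tiling) (S W : int -> int -> int) (p q i j : int).

Lemma out_labelling D S W p q : matching D -> boxed p q D ->
  (forall i j, q <= i -> S i j = j) ->
  (forall i j, ~~ (p <= j <= q) -> S i j = j) ->
  (forall i j, ~~ (p <= i <= q) -> W i j = i) ->
  (forall i j, p <= i <= q -> p <= j ->
     S (i - 1) j = nout (D i j) (W i j) (S i j) /\
     W i (j + 1) = eout (D i j) (W i j) (S i j)) ->
  is_labelling D S W.
Proof.
move=> mD bD Sq Sout Wout rule; split=> [j|i j]; first by exists q => i qi; exact: Sq.
have [/andP[iq jq]|out] := boolP ((p <= i <= q) && (p <= j <= q)).
  have [pj _] := andP jq; have [SE WE] := rule i j iq pj.
  rewrite /follow; move: SE WE; case DE : (D i j) => //= SE WE.
  have [||ne iff] := @already_iff D S W p q i j mD bD _ _ DE.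
  - by move=> k _; exact: Sq.
  - move=> k l kq lj kl; apply: out_local; first exact: matching_tok.
      by apply: (rule _ _ _ _).1; lia.
    by apply: (rule _ _ _ _).2; lia.
  rewrite SE WE; split=> [/iff lt|/iff nlt].
    by split; lia.
  by split; lia.
rewrite /follow bD // /hooks; case: eqP => [ij|ij].
  by rewrite -ij in out *; rewrite Wout ?Sout //; lia.
case: ifP => ji.
  have [jq|jq] := boolP (p <= j <= q); last by rewrite !Sout.
  by rewrite !Sq; lia.
have [iq|iq] := boolP (p <= i <= q); last by rewrite !Wout.
by rewrite (rule i j iq _).2 ?bD ?hooks_above //; lia.
Qed.

Lemma labelling_east p q D S W w i : boxed p q D -> is_labelling D S W ->
  (exists C : int, forall c, C <= c -> W i c = w) -> i <= q -> W i (q + 1) = w.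
Proof.
move=> bD [_ fo] [C WC] iq; have [Cq|qC] := lerP C (q + 1); first exact: WC.
apply: (@down_from (fun c => W i c = w) C); [lia|exact: WC|].
move=> k kC; have := fo i (k - 1); by rewrite /follow bD ?hooks_above ?subrK //; lia.
Qed.

End Labels.

Section Runs.
Implicit Types (D : tiling) (cs : seq (int * int)) (v : lword).

Lemma run_cat D cs cs' v : run D (cs ++ cs') v = run D cs' (run D cs v).
Proof. exact: foldl_cat. Qed.

Lemma valid_cat D cs cs' v :
  valid D (cs ++ cs') v = valid D cs v && valid D cs' (run D cs v).
Proof. by elim: cs v => //= c cs IH v; rewrite IH andbA. Qed.

Variables (D : tiling) (sl wl : int -> int -> label) (p q : int) (n : nat).
Let e := p + n%:Z.
Hypothesis wl0 : forall i, p <= i <= q -> wl i p = None.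
(** Conditional on [tok], because the labels built for a tiling not yet known to match satisfy no
    more than this. *)
Hypothesis loc : forall i j, p <= i <= q -> p <= j < e ->
  tok (D i j) (wl i j) (sl i j) -> local_rule D sl wl i j.

Lemma valid_row i (h : nat) : p <= i <= q -> (h <= n)%N ->
  (valid D (rowcells p i h) (cur sl wl p q e i p) <->
   forall j, p <= j < p + h%:Z -> tok (D i j) (wl i j) (sl i j)) /\
  (valid D (rowcells p i h) (cur sl wl p q e i p) ->
   run D (rowcells p i h) (cur sl wl p q e i p) = cur sl wl p q e i (p + h%:Z)).
Proof.
move=> iq; elim: h => [_|h IH hn].
  by split; [split => // _ j; lia | move=> _; rewrite addr0].
have {}[IH1 IH2] := IH (ltnW hn).
rewrite rowcellsS -cats1 valid_cat run_cat /=.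
have tk : valid D (rowcells p i h) (cur sl wl p q e i p) ->
    tok (D i (p + h%:Z))
      (run D (rowcells p i h) (cur sl wl p q e i p) (cpos (i, p + h%:Z)))
      (run D (rowcells p i h) (cur sl wl p q e i p) (cpos (i, p + h%:Z) + 1)) =
    tok (D i (p + h%:Z)) (wl i (p + h%:Z)) (sl i (p + h%:Z)).
  by move=> /IH2 ->; rewrite /cpos /= cur_west ?cur_south //; rewrite /e; lia.
split; first split.
- move=> /andP[v1]; rewrite tk // andbT => t1 j jh.
  have [->//|jh'] := eqVneq j (p + h%:Z); apply: IH1.1 => //; lia.
- move=> h1; have v1 : valid D (rowcells p i h) (cur sl wl p q e i p).
    by apply: IH1.2 => j jh; apply: h1; lia.
  by rewrite v1 tk //= h1 //; lia.
- move=> /andP[v1]; rewrite tk // andbT => t1; rewrite IH2 // (@cur_step D).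
  + by congr cur; lia.
  + by rewrite /e; lia.
  + by lia.
  + by apply: loc => //; rewrite /e; lia.
Qed.

Lemma valid_grid (m : nat) : p + m%:Z <= q ->
  (valid D (gridcells p n m.+1) (cur sl wl p q e (p + m%:Z) p) <->
   forall i j, p <= i <= p + m%:Z -> p <= j < e -> tok (D i j) (wl i j) (sl i j)) /\
  (valid D (gridcells p n m.+1) (cur sl wl p q e (p + m%:Z) p) ->
   run D (gridcells p n m.+1) (cur sl wl p q e (p + m%:Z) p) = cur sl wl p q e p e).
Proof.
elim: m => [|m IH] mq.
  have [||r1 r2] := @valid_row p n; [lia|by []|].
  rewrite /= addr0 cats0; split => //; rewrite r1; split=> h.
    move=> i j ip; have -> : i = p by lia.
    exact: h.
  by move=> j; apply: h; lia.
have [|IH1 IH2] := IH; first by lia.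
have [||r1 r2] := @valid_row (p + m.+1%:Z) n; [lia|by []|].
have nx : cur sl wl p q e (p + m.+1%:Z) e = cur sl wl p q e (p + m%:Z) p.
  rewrite (_ : p + m%:Z = p + m.+1%:Z - 1); last by lia.
  by apply: cur_row; [rewrite /e; lia|lia|apply: wl0; lia].
rewrite [gridcells _ _ _]/(_ ++ gridcells p n m.+1) valid_cat run_cat.
have E : valid D (rowcells p (p + m.+1%:Z) n) (cur sl wl p q e (p + m.+1%:Z) p) ->
    run D (rowcells p (p + m.+1%:Z) n) (cur sl wl p q e (p + m.+1%:Z) p) =
    cur sl wl p q e (p + m%:Z) p by move=> /r2 ->.
split; first split.
- move=> /andP[v1]; rewrite E // => v2 i j im je.
  have [->|im'] := eqVneq i (p + m.+1%:Z); first exact: r1.1.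
  by apply: IH1.1 => //; lia.
- move=> h; have v1 : valid D (rowcells p (p + m.+1%:Z) n) (cur sl wl p q e (p + m.+1%:Z) p).
    by apply: r1.2 => j je; apply: h => //; lia.
  by rewrite v1 E //=; apply: IH1.2 => i j im je; apply: h => //; lia.
- by move=> /andP[v1]; rewrite E // => /IH2.
Qed.

End Runs.

(** * Pipe dreams with a given permutation *)

Section Correspondence.
Implicit Types (D : tiling) (w : int -> int) (p q i j : int).

Lemma matching_hooks : matching hooks.
Proof.
by move=> i j; rewrite /hooks; split; do 4?case: ifP => //; lia.
Qed.

Lemma labels_kbpd_of p q D S W w : boxed p q D -> matching D ->
  (forall i j, q <= i -> S i j = j) ->
  (forall i j, ~~ (p <= j <= q) -> S i j = j) ->
  (forall i j, ~~ (p <= i <= q) -> W i j = i) ->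
  (forall i j, p <= i <= q -> p <= j ->
     S (i - 1) j = nout (D i j) (W i j) (S i j) /\
     W i (j + 1) = eout (D i j) (W i j) (S i j)) ->
  (forall i, p <= i <= q -> W i (q + 1) = w i) ->
  (forall i, ~~ (p <= i <= q) -> w i = i) ->
  kbpd_of w D.
Proof.
move=> bD mD Sq So Wo rule Wq wo; split; first exact: boxed_kbpd bD mD.
exists S, W; split; first exact: out_labelling bD Sq So Wo rule.
move=> i; exists (q + 1) => c qc.
have [iq|iq] := boolP (p <= i <= q); last by rewrite Wo // wo.
apply: (@up_from (fun k => W i k = w i) (q + 1)) => //; first exact: Wq.
move=> k kc Wk; rewrite (rule i k iq _).2; last by lia.
by rewrite bD ?hooks_above //; lia.
Qed.

Variables (p : int) (n : nat).
Let q := p + n%:Z - 1.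

Lemma bword_start : bword p n id = start p q.
Proof.
by apply/funext => k; rewrite /bword /start /q; do 2?case: ifP => ? //; exfalso; lia.
Qed.

Lemma cur_end D S W w : (0 < n)%N -> in_box p n w ->
  (cur (slab D S) (wlab D W) p q (p + n%:Z) p (p + n%:Z) = bword p n w <->
  (forall j, p <= j <= q -> slab D S (p - 1) j = None) /\
  (forall i, p <= i <= q -> wlab D W i (q + 1) = Some (w i))).
Proof.
move=> n0 wb; split=> [E|[s0 w0]].
  split=> [j jq|i iq].
    move: (congr1 (fun v => v (p + j - 1)) E); rewrite /cur /bword /q in jq *.
    do ![case: ifP => ?]; try lia; rewrite (_ : p + j - 1 - p + 1 = j) //; lia.
  move: (congr1 (fun v => v (i + q)) E); rewrite /cur /bword /q in iq *.
  rewrite [X in _ = X](_ : _ = Some (w i)); last first.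
    by rewrite ifT; [congr (Some (w _))|]; lia.
  move=> <-; do ![case: ifP => ?]; try lia; congr wlab; lia.
apply/funext => k; rewrite /cur /bword.
do ![case: ifP => ?]; try lia; rewrite ?s0 //; rewrite ?/q; try lia.
- rewrite (_ : p + n%:Z = q + 1) ?w0 /q; try lia.
  by congr (Some (w _)); lia.
- rewrite (_ : p + n%:Z = q + 1) ?w0 /q; try lia.
  by congr (Some (w _)); lia.
- by rewrite wb; [congr Some; lia|lia].
Qed.

Lemma kbpd_of_run D w : in_box p n w -> boxed p q D ->
  kbpd_of w D <-> valid D (gridcells p n n) (bword p n id) /\
    run D (gridcells p n n) (bword p n id) = bword p n w.
Proof.
move=> wb bD; have wo i : ~~ (p <= i <= q) -> w i = i.
  by move=> iq; apply: wb; rewrite /q in iq; lia.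
(* The empty box is separate: [valid_grid] needs at least one row. *)
have [n0|n0] := posnP n.
  have wid : w = id by apply/funext => i; apply: wo; rewrite /q; lia.
  have Dh : D = hooks.
    by apply/funext => i; apply/funext => j; apply: bD; rewrite /q; lia.
  split=> _; first by rewrite n0 wid.
  have [S [W [Sq So Wo rule]]] := labels_exist bD.
  apply: (labels_kbpd_of bD _ Sq So Wo rule) => //.
    by rewrite Dh; exact: matching_hooks.
  by move=> i; rewrite /q; lia.
have nE : n = n.-1.+1 by rewrite prednK.
have qE : p + n.-1%:Z = q by rewrite /q; lia.
have key S W : (forall j, p <= j <= q -> S q j = j) ->
    (forall i j, p <= i <= q -> p <= j < p + n%:Z ->
       tok (D i j) (wlab D W i j) (slab D S i j) ->
       local_rule D (slab D S) (wlab D W) i j) ->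
    (valid D (gridcells p n n) (bword p n id) <->
     forall i j, p <= i <= q -> p <= j <= q ->
       tok (D i j) (wlab D W i j) (slab D S i j)) /\
    (valid D (gridcells p n n) (bword p n id) ->
     run D (gridcells p n n) (bword p n id) =
     cur (slab D S) (wlab D W) p q (p + n%:Z) p (p + n%:Z)).
  move=> S0 loc.
  have st : bword p n id = cur (slab D S) (wlab D W) p q (p + n%:Z) q p.
    rewrite bword_start cur_start //; first by lia.
      by apply: boxed_wlab bD _; rewrite /q; lia.
    by move=> j jq; rewrite (boxed_slab _ bD) ?S0 // /q; lia.
  have [||v1 v2] := @valid_grid D (slab D S) (wlab D W) p q n _ loc n.-1.
  - by move=> i iq; apply: boxed_wlab bD _; lia.
  - by rewrite qE.
  rewrite -nE qE -st in v1 v2; split => //; rewrite v1; split=> h i j iq jq;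
    by apply: h => //; rewrite /q in jq *; lia.
split=> [[kD [S [W [lab ex]]]]|].
  have [mD _ _] := kD; have loc := labelling_local mD bD lab.
  have [|v1 v2] := key S W (labelling_south bD lab).
    by move=> i j iq jq _; apply: loc => //; rewrite /q; lia.
  have v : valid D (gridcells p n n) (bword p n id).
    by apply/v1 => i j _ _; exact: matching_tok.
  split => //; rewrite v2 // cur_end //; split=> [j jq|i iq].
    by rewrite slab_pred -matching_south // bD ?hooks_above //; lia.
  rewrite wlab_succ (mD i q).2 bD ?hooks_above //; try lia.
  by rewrite (labelling_east bD lab (ex i)) //; lia.
move=> [v rE]; have [S [W [Sq So Wo rule]]] := labels_exist bD.
have [||v1 v2] := key S W.
- by move=> j _; exact: Sq.
- move=> i j iq jq t; apply: out_local => //; first by apply: (rule _ _ _ _).1; lia.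
  by apply: (rule _ _ _ _).2; lia.
have tk := v1.1 v; have [s0 w0] := (cur_end D S W n0 wb).1 (etrans (esym (v2 v)) rE).
apply: (labels_kbpd_of bD _ Sq So Wo rule) => //; last first.
  by move=> i iq; have := w0 i iq; rewrite wlab_succ; case: ifP => // _ [].
(* Inside the box matching is [tok]; across the north and east sides it is read off the final word;
   elsewhere both tiles come from [hooks]. *)
move=> i j; split.
  have [/andP[iq jq]|o1] := boolP ((p <= i <= q) && (p <= j <= q)).
    by have /andP[_ /eqP ->] := tk i j iq jq; rewrite /slab; case: north.
  have [/andP[iq jq]|o2] := boolP ((p <= i + 1 <= q) && (p <= j <= q)).
    have := s0 j jq; rewrite slab_pred (bD i j) // (_ : i + 1 = p); last by lia.
    by case: north => // _; rewrite hooks_above //; lia.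
  by rewrite !bD //; case: (matching_hooks i j).
have [/andP[iq jq]|o1] := boolP ((p <= i <= q) && (p <= j + 1 <= q)).
  have /andP[/eqP -> _] := tk i (j + 1) iq jq.
  by rewrite /wlab addrK; case: east.
have [/andP[iq jq]|o2] := boolP ((p <= i <= q) && (p <= j <= q)).
  have jE : j = q by lia.
  have := w0 i iq; rewrite wlab_succ jE; case: east => // _.
  by rewrite bD ?hooks_above //; lia.
by rewrite !bD //; case: (matching_hooks i j).
Qed.

End Correspondence.

(** * The limit *)

Section Limit.
Implicit Types (D : tiling) (w : int -> int) (p q i j : int) (n : nat).
Implicit Types (m : {cmonom var}).

Lemma tilings_boxed p n D :
  D \in tilings (gridcells p n n) <-> boxed p (p + n%:Z - 1) D.
Proof.
split=> [/tilingsP h i j out|h].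
  by apply: h; apply/negP => /gridcellsP /= ?; move: out; lia.
apply/tilingsP => i j out; apply: h; apply: contraNN out => ?.
by apply/gridcellsP => /=; lia.
Qed.

Lemma pfun_sum p n w : in_box p n w ->
  pfun xs ys p n w = \sum_(D <- tilings (gridcells p n n) | `[< kbpd_of w D >]) wt D.
Proof.
move=> wb; have uc := gridcells_uniq p n n.
rewrite /pfun evalc_tilings // big_seq_cond [RHS]big_seq_cond.
rewrite big_mkcond [RHS]big_mkcond; apply: eq_bigr => D _.
have [Dt|//] := boolP (D \in _); rewrite /=.
have [k1 k2] := kbpd_of_run wb ((tilings_boxed p n D).1 Dt).
case: ifPn => [v|nv]; last first.
  by case: asboolP => // /k1 [v]; rewrite v in nv.
rewrite /ind; case: asboolP => [rE|nE].
  rewrite asboolT ?mulr1; last exact: k2.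
  rewrite (wt_tilings uc Dt); apply: eq_bigr => c _.
  by rewrite ominusE.
by rewrite mulr0; case: asboolP => // /k1 [_ /nE].
Qed.

(** The size [n'] is the one behind the choice in [groth]; the derivation for [n] only ensures that
    this choice is not the default. *)
Lemma bs_approx_sum p n w : bijective w -> in_box p n w ->
  exists2 n', in_box p n' w & bs_approx w p = (-1) ^+ len w *
    \sum_(D <- tilings (gridcells p n' n') | `[< kbpd_of w D >]) wt D.
Proof.
move=> wB wb; set u := gamma (1 - p) w.
have uw : gamma (p - 1) u = w.
  by rewrite /u (_ : p - 1 = - (1 - p)) ?gammaK //; lia.
have ub : in_box 1 n u.
  by have := @gamma_in_box (1 - p) p n w wb; rewrite (_ : p + (1 - p) = 1) //; lia.
have [f gf] := is_groth_exists (gamma_bij (1 - p) wB) ub.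
rewrite /bs_approx /groth -/u; case: xgetP => [g -> [n' gg]|/(_ f) []]; last by exists n.
have [_ ub'] := is_groth_box gg.
have wb' : in_box p n' w.
  rewrite -uw; have := @gamma_in_box (p - 1) 1 n' u ub'.
  by rewrite (_ : 1 + (p - 1) = p) //; lia.
exists n' => //; rewrite (groth_pfun p gg) uw (pfun_sum wb') /u len_gamma //.
exact: in_box_SZ wB wb.
Qed.

(** In the bottom row a label on the west edge of column [k] is less than [k]; hence pipe [q], which
    exits there, comes up in column [q] and turns. *)
Lemma corner_SE p q w D : kbpd_of w D -> boxed p q D -> p <= q -> w q = q ->
  D q q = SE.
Proof.
move=> [[mD _ _] [S [W [lab ex]]]] bD pq wq.
have S0 := labelling_south bD lab; have loc := labelling_local mD bD lab.
have sl j : p <= j <= q -> slab D S q j = Some j.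
  by move=> jq; rewrite (boxed_slab _ bD) ?S0 //; lia.
have small j : p <= j <= q -> forall c, wlab D W q j = Some c -> c < j.
  move=> jq; have [pj _] := andP jq.
  apply: (@up_from (fun k => forall c, wlab D W q k = Some c -> c < k) p) => //.
    by move=> c; rewrite (boxed_wlab _ bD).
  move=> k kj IH c; have := loc q k (ltac:(lia)) (ltac:(lia)).
  rewrite /local_rule sl; last by lia.
  by case: ifP => _ [_ ->]; [move=> /IH | case]; lia.
have qq : p <= q <= q by lia.
have {}small := small q qq; have := loc q q qq qq; rewrite /local_rule sl //.
have e1 : wlab D W q (q + 1) = Some q.
  rewrite wlab_succ (mD q q).2 bD ?hooks_above //; try lia.
  by rewrite (labelling_east bD lab (ex q)) // wq.
rewrite e1; case: ifP => [_ [_ E]|sw _]; first by have := small _ (esym E); lia.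
move: sw (matching_tok S W q q mD); rewrite sl //.
case: (D q q) => //=; case wE : (wlab D W q q) => [c|] //=.
by have := small c wE; lia.
Qed.

Lemma boxed_empty p q D : boxed p q D -> q < p -> D = hooks.
Proof. by move=> bD qp; apply/funext => i; apply/funext => j; apply: bD; lia. Qed.

Lemma kbpd_of_boxed w D q : kbpd_of w D -> (forall i, q < i -> w i = i) ->
  exists p, forall p', p' <= p -> boxed p' q D.
Proof.
move=> kw wq; have [kD _] := kw; have [mD _ _] := kD.
have [M [M0 bM]] := kbpd_boxed kD; exists (- M) => p' pM.
have bD : boxed p' (Num.max M q) D by apply: boxed_widen bM; lia.
apply: (@down_from (fun k => boxed p' k D) (Num.max M q)) => //; first by lia.
move=> k kq bk; have [pk|kp] := lerP p' k; last first.
  by rewrite (boxed_empty bk kp).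
by apply: boxed_trim_SE => //; apply: corner_SE kw bk pk _; apply: wq; lia.
Qed.

Lemma coef_ominusM i j (g : fps var) m :
  m (inl i : var) = 0%N -> m (inr j : var) = 0%N ->
  coef (ominus (x i) (a j) * g) m = 0.
Proof.
move=> mi mj; rewrite /ominus -mulrA; set h := _ * g.
rewrite mulrBl coefB /x /a.
by rewrite [X in X - _]coefXM [X in _ - X]coefXM mi mj subrr.
Qed.

Lemma coef_wt_corner p n D m : D p p = Empty -> boxed p (p + n%:Z - 1) D ->
  m (inl p : var) = 0%N -> m (inr p : var) = 0%N -> coef (wt D) m = 0.
Proof.
move=> Dp bD mx ma; have [n0|n0] := posnP n.
  by move: Dp; rewrite bD ?hooks_diag //; lia.
have pg : (p, p) \in gridcells p n n by apply/gridcellsP => /=; lia.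
rewrite (wt_tilings (gridcells_uniq p n n) ((tilings_boxed p n D).2 bD)).
rewrite (bigD1_seq (p, p)) ?gridcells_uniq //= Dp /=.
by rewrite mulNr coefN coef_ominusM ?oppr0.
Qed.

(** From a box large enough for [D], the north-west corner is trimmed up to [p]: an empty corner at
    [k < p] would put [x_k] or [a_k] into every monomial of the weight. *)
Lemma kbpd_of_coef w D p n m : kbpd_of w D -> in_box p n w ->
  (forall i, i < p -> m (inl i : var) = 0%N /\ m (inr i : var) = 0%N) ->
  coef (wt D) m <> 0 -> D \in tilings (gridcells p n n).
Proof.
move=> kw wb m0 cD; apply/tilings_boxed; set q := p + n%:Z - 1.
have [[mD _ _] _] := kw.
have [|p1 bp1] := @kbpd_of_boxed w D q kw.
  by move=> i qi; apply: wb; rewrite /q in qi; lia.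
apply: (@up_from (fun k => boxed k q D) (Num.min p p1)); first by lia.
  by apply: bp1; lia.
move=> k kp bk; have [kq|qk] := lerP k q; last by rewrite (boxed_empty bk qk).
apply: boxed_trim_NW => // Dk; apply: cD.
have [mx ma] : m (inl k : var) = 0%N /\ m (inr k : var) = 0%N by apply: m0; lia.
apply: (@coef_wt_corner k (absz (q - k + 1)%R) D) => //.
by rewrite (_ : k + (absz (q - k + 1)%R)%:Z - 1 = q) //; lia.
Qed.

End Limit.

Lemma coef_sum (I T : choiceType) (r : seq T) (P : pred T) (F : T -> fps I) m :
  coef (\sum_(t <- r | P t) F t) m = \sum_(t <- r | P t) coef (F t) m.
Proof. exact: (big_morph (fun f => coef f m) (fun f g => coefD f g m) erefl). Qed.

Lemma coef_signM (I : choiceType) (k : nat) (f : fps I) m :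
  coef ((-1) ^+ k * f) m = (-1) ^+ k * coef f m.
Proof.
rewrite -[in LHS]signr_odd -[in RHS]signr_odd.
by case: (odd k); rewrite ?mulN1r ?mul1r.
Qed.

Lemma cmonom_bound (m : {cmonom var}) :
  exists P : int, forall i, i < P -> m (inl i : var) = 0%N /\ m (inr i : var) = 0%N.
Proof.
pose idx (v : var) : nat := match v with inl i => absz i | inr i => absz i end.
pose B := (\sum_(v <- finsupp m) idx v)%N; exists (- B%:Z) => i iB.
have out (v : var) : idx v = absz i -> m v = 0%N.
  move=> vi; apply/eqP; rewrite cmE_eq0; apply/negP => vm.
  have : (idx v <= B)%N by rewrite /B (big_fsetD1 v) //=; exact: leq_addr.
  by rewrite vi; lia.
by split; exact: out.
Qed.

Lemma in_box_widen p n w p' : in_box p n w -> p' <= p ->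
  exists n', in_box p' n' w.
Proof.
move=> wb pp; exists (absz (p + n%:Z - p')%R) => i ip; apply: wb; lia.
Qed.

Lemma wt_summable w : SZ w -> summable (kbpd_of w) wt.
Proof.
move=> wS m; have [p0 [n0 wb0]] := SZ_in_box wS; have [P mP] := cmonom_bound m.
have [|n wb] := @in_box_widen p0 n0 w (Num.min p0 P) wb0; first by lia.
apply: (@sub_finite_set _ _ [set` tilings (gridcells (Num.min p0 P) n n)]).
  move=> D [kD /eqP cD]; apply: (kbpd_of_coef kD wb _ cD) => i ip.
  by apply: mP; lia.
exact: finite_seq.
Qed.

(** Once [p] lies below the support of [w] and the variables of [m], pipe dreams outside the box
    contribute nothing to the coefficient of [m]: the finite sum is already exact. *)
Lemma bs_approx_limit w : SZ w ->
  fps_limit (bs_approx w) ((-1) ^+ len w * fps_sum (kbpd_of w) wt).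
Proof.
move=> wS m; have [p0 [n0 wb0]] := SZ_in_box wS; have [P mP] := cmonom_bound m.
exists (Num.min p0 P) => p pP.
have [|n1 wb1] := @in_box_widen p0 n0 w p wb0; first by lia.
have [n wb ->] := bs_approx_sum wS.1 wb1.
rewrite !coef_signM coef_sum; congr (_ * _).
rewrite -big_filter [RHS](fsbigE [seq D <- tilings (gridcells p n n) | `[< kbpd_of w D >]]).
- rewrite big_mkcond [RHS]big_mkcond big_seq [RHS]big_seq; apply: eq_bigr => D.
  by rewrite mem_filter => /andP[/asboolP kD _]; rewrite mem_set.
- by apply/filter_uniq/tilings_uniq/gridcells_uniq.
- by move=> D /=; rewrite mem_filter => /andP[/asboolP].
move=> D kD; rewrite mem_filter asboolT //= => Dt.
apply/eqP; apply: contraNT Dt => /eqP cD; apply: (kbpd_of_coef kD wb _ cD) => i ip.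
by apply: mP; lia.
Qed.

(** Convergence and summability are part of the conclusion because [bs_groth] and [fps_sum] would
    otherwise rest on default values. *)
Theorem theorem6p2 (w : int -> int) (hw : SZ w) :
  [/\ fps_limit (bs_approx w) (bs_groth w),
      summable (kbpd_of w) wt &
      bs_groth w = (-1) ^+ len w * fps_sum (kbpd_of w) wt].
Proof.
have lim := bs_approx_limit hw.
have E : bs_groth w = (-1) ^+ len w * fps_sum (kbpd_of w) wt.
  apply: (fps_limit_uniq _ lim); rewrite /bs_groth.
  exact: (xgetPex 0 (ex_intro _ _ lim)).
by split; [rewrite E | exact: wt_summable | ].
Qed.
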